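(* (1) Let $n\ge 1$. A subset of $\mathbb Z^n$ is polyhedral if and only if it is semilinear. (2) Let $G$ be a finitely generated virtually abelian group with a normal free abelian subgroup $\mathbb Z^k$ of finite index. (i) For a subset $U\subseteq G$ the following are equivalent: $U$ is coset-wise polyhedral; $U$ is rational; $U$ is $\mathbb Z^k$-semilinear. (ii) For every $q\ge 1$, every definable set $V\subseteq G^q$ is a rational subset of $G^q$.
   Context: Polyhedral sets. An elementary region of $\mathbb Z^r$ is a set $\{z:u\cdot z=a\}$, $\{z:u\cdot z\equiv a \bmod b\}$ or $\{z:u\cdot z>a\}$ with $u\in\mathbb Z^r$, $a\in\mathbb Z$, $b\in\mathbb N$ ($\cdot$ the Euclidean scalar product). A polyhedral set is a finite union of finite intersections of elementary regions. Semilinear sets. For a commutative monoid $M$ (written additively), $L\subseteq M$ is linear if $L=a+B^*$ for some $a\in M$ and some finite $B\subseteq M$, where $B^*$ is the submonoid generated by $B$; a semilinear set is a finite union of linear sets. Rational sets. For a group $M$ with finite monoid generating set $A$, a subset $R\subseteq M$ is rational if it is the image of a regular language $L\subseteq A^*$ under the natural projection $A^*\to M$ (independent of the choice of $A$). Coset-wise polyhedral sets. Let $T$ be a transversal for the cosets of $\mathbb Z^k$ in $G$. A subset $V\subseteq G$ is coset-wise polyhedral if for each $t\in T$ the set $V_t=\{gt^{-1}: g\in V\cap\mathbb Z^kt\}\subseteq\mathbb Z^k$ is polyhedral (this is independent of the choice of $T$). $N$-semilinear sets. Let $M$ be a monoid and $N$ a submonoid of $M$. A set $X\subseteq M$ is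 $N$-linear if $X=aB^*$, where $a\in M$, $B\subseteq N$ is a finite basis of a free abelian submonoid $B^*$ of $N$, and multiplication by $a$ gives a bijection $B^*\to aB^*$. $X$ is $N$-semilinear if it is a finite disjoint union of $N$-linear sets. Here this is applied with $M=G$, $N=\mathbb Z^k$. Definable sets. $V\subseteq G^q$ is definable if there are a first-order formula $\Phi(x_1,\dots,x_q,y_1,\dots,y_n)$ in the language of groups and parameters $m_1,\dots,m_n\in G$ such that $V=\{\overline g\in G^q:\Phi(\overline g,m_1,\dots,m_n)\text{ holds in }G\}$. *)

(* Defs.v *)
From mathcomp Require Import all_boot all_order all_algebra.
From mathcomp Require Import boolp classical_sets functions cardinality.

Set Implicit Arguments.
Unset Strict Implicit.
Unset Printing Implicit Defensive.

Local Open Scope classical_set_scope.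

Definition finite_union (T : Type) (C : set (set T)) (X : set T) : Prop :=
  exists (r : nat) (Y : 'I_r -> set T),
    (forall i, C (Y i)) /\ X = \bigcup_i Y i.

Definition finite_inter (T : Type) (C : set (set T)) (X : set T) : Prop :=
  exists (r : nat) (Y : 'I_r -> set T),
    (forall i, C (Y i)) /\ X = \bigcap_i Y i.

Definition dotz (r : nat) (u z : 'rV[int]_r) : int :=
  (\sum_(i < r) u ord0 i * z ord0 i)%R.

(* For b = 0 the congruence of intdiv is equality, so allowing it adds no
   region beyond those of the first kind. *)
Variant elementary (r : nat) : set 'rV[int]_r -> Prop :=
| Elem_eq (u : 'rV[int]_r) (a : int) :
    elementary [set z | dotz u z = a]
| Elem_mod (u : 'rV[int]_r) (a : int) (b : nat) :
    elementary [set z | (dotz u z = a %[mod b%:Z])%Z]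
| Elem_gt (u : 'rV[int]_r) (a : int) :
    elementary [set z | (a < dotz u z)%R].

Definition polyhedral_set (r : nat) : set (set 'rV[int]_r) :=
  finite_union (finite_inter (@elementary r)).

Definition add_submonoid (M : nmodType) (S : set M) : Prop :=
  S 0%R /\ forall x y, S x -> S y -> S (x + y)%R.

Definition linear_set (M : nmodType) (L : set M) : Prop :=
  exists (a : M) (B : set M),
    finite_set B /\ L = [set (a + x)%R | x in smallest (@add_submonoid M) B].

Definition semilinear_set (M : nmodType) : set (set M) :=
  finite_union (@linear_set M).

Local Open Scope group_scope.

Definition submonoid (M : monoidType) (S : set M) : Prop :=
  S 1 /\ forall x y, S x -> S y -> S (x * y).

Definition monoid_gen (M : monoidType) (B : set M) : set M :=
  smallest (@submonoid M) B.

Definition finite_monoid_generating_set (M : monoidType) (A : set M) : Prop :=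
  finite_set A /\ monoid_gen A = setT.

Definition subgroup (G : groupType) (H : set G) : Prop :=
  H 1 /\ forall x y, H x -> H y -> H (x * y^-1).

Definition finitely_generated (G : groupType) : Prop :=
  exists A : set G, finite_set A /\ smallest (@subgroup G) A = setT.

Definition right_coset (G : groupType) (H : set G) (t : G) : set G :=
  [set h * t | h in H].

Definition normal_subgroup (G : groupType) (H : set G) : Prop :=
  subgroup H /\ forall g h, H h -> H (g * h * g^-1).

Definition finite_index (G : groupType) (H : set G) : Prop :=
  finite_set (range (right_coset H)).

Definition coset_transversal (G : groupType) (H T : set G) : Prop :=
  forall g, exists! t, T t /\ right_coset H t g.

(* A subgroup Z^k of G is given by an injective homomorphism 'rV[int]_k -> G. *)
Definition embedding (k : nat) (G : groupType) (iota : 'rV[int]_k -> G) : Prop :=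
  {morph iota : x y / (x + y)%R >-> x * y} /\ injective iota.

Inductive regular (T : eqType) (A : set T) : set (seq T) -> Prop :=
| Regular_empty : regular A set0
| Regular_eps : regular A [set [::]]
| Regular_letter (a : T) : A a -> regular A [set [:: a]]
| Regular_union (K L : set (seq T)) :
    regular A K -> regular A L -> regular A (K `|` L)
| Regular_cat (K L : set (seq T)) :
    regular A K -> regular A L -> regular A [set u ++ v | u in K & v in L]
| Regular_star (L : set (seq T)) :
    regular A L ->
    regular A [set flatten ws |
      ws in [set ws : seq (seq T) | forall w, w \in ws -> L w]].

(* Words over A are sequences of elements of M, so that the projection from
   A^* to M is the product of the letters. A is meant to be a finite monoid
   generating set of M. *)
Definition rational (M : groupType) (A R : set M) : Prop :=
  exists L : set (seq M),
    regular A L /\ R = [set \prod_(x <- w) x | w in L].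

Definition cosetwise_polyhedral (k : nat) (G : groupType)
    (iota : 'rV[int]_k -> G) (T V : set G) : Prop :=
  forall t, T t ->
    polyhedral_set (iota @^-1`
      [set g * t^-1 | g in V `&` right_coset (range iota) t]).

(* B = {b_0, ..., b_(r-1)} is a basis of a free abelian monoid: its elements
   commute and distinct exponent vectors give distinct products. Injectivity
   forces the b_i to be distinct and different from 1. *)
Definition finite_free_abelian_basis (M : monoidType) (B : set M) : Prop :=
  exists (r : nat) (b : 'I_r -> M),
    [/\ B = range b,
        forall i j, commute (b i) (b j) &
        injective (fun n : {ffun 'I_r -> nat} => \prod_(i < r) b i ^+ n i)].

Definition N_linear (M : monoidType) (N X : set M) : Prop :=
  exists (a : M) (B : set M),
    [/\ B `<=` N,
        finite_free_abelian_basis B,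
        set_bij (monoid_gen B) [set a * x | x in monoid_gen B] (fun x => a * x)
      & X = [set a * x | x in monoid_gen B]].

Definition N_semilinear (M : monoidType) (N X : set M) : Prop :=
  exists (r : nat) (Y : 'I_r -> set M),
    [/\ forall i, N_linear N (Y i), trivIset setT Y & X = \bigcup_i Y i].

Inductive gterm (n : nat) : Type :=
| GVar of 'I_n
| GOne
| GMul of gterm n & gterm n
| GInv of gterm n.

(* gform n: formulas with free variables indexed by 'I_n. Under a quantifier
   the bound variable is ord0 and variable i of the context is lift ord0 i. *)
Inductive gform : nat -> Type :=
| GEq n : gterm n -> gterm n -> gform n
| GNot n : gform n -> gform n
| GAnd n : gform n -> gform n -> gform n
| GOr n : gform n -> gform n -> gform n
| GImpl n : gform n -> gform n -> gform n
| GExists n : gform n.+1 -> gform n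
| GForall n : gform n.+1 -> gform n.

Fixpoint gteval (G : groupType) (n : nat) (e : 'I_n -> G) (t : gterm n) : G :=
  match t with
  | GVar i => e i
  | GOne => 1
  | GMul t1 t2 => gteval e t1 * gteval e t2
  | GInv t1 => (gteval e t1)^-1
  end.

Definition extend (G : Type) (n : nat) (x : G) (e : 'I_n -> G) : 'I_n.+1 -> G :=
  fun i => if unlift ord0 i is Some j then e j else x.

Fixpoint gholds (G : groupType) (n : nat) (f : gform n) : ('I_n -> G) -> Prop :=
  match f in gform m return ('I_m -> G) -> Prop with
  | GEq _ t1 t2 => fun e => gteval e t1 = gteval e t2
  | GNot _ f1 => fun e => ~ gholds f1 e
  | GAnd _ f1 f2 => fun e => gholds f1 e /\ gholds f2 e
  | GOr _ f1 f2 => fun e => gholds f1 e \/ gholds f2 e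
  | GImpl _ f1 f2 => fun e => gholds f1 e -> gholds f2 e
  | GExists _ f1 => fun e => exists x : G, gholds f1 (extend x e)
  | GForall _ f1 => fun e => forall x : G, gholds f1 (extend x e)
  end.

Definition join_env (G : Type) (q n : nat) (g : 'I_q -> G) (m : 'I_n -> G) :
    'I_(q + n) -> G :=
  fun i => match fintype.split i with inl j => g j | inr j => m j end.

Definition definable (G : groupType) (q : nat) (V : set {ffun 'I_q -> G}) : Prop :=
  exists (n : nat) (Phi : gform (q + n)) (m : 'I_n -> G),
    V = [set g : {ffun 'I_q -> G} | gholds Phi (join_env g m)].

(* Main.v *)
Require Import Defs.
From HB Require Import structures.
From mathcomp Require Import all_boot all_order all_algebra.
From mathcomp Require Import boolp classical_sets functions cardinality.
From mathcomp Require Import zify ring.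

(* The engine is one decomposition: a free linear set (a + N-combinations of a
   Z-independent list B), intersected with a condition on an additive functional
   u that is eventually periodic in both directions, is a finite disjoint union
   of free linear sets. Replacing each b in B by multiples makes all nonzero
   values u b equal to +L or -L; splitting on which of two coefficients is
   larger then replaces a pair b, c of opposite values by b, b + c or
   c, b + c with u (b + c) = 0; once all signs agree, boundedly many
   coefficients matter before the condition becomes constant. Sets that refine
   free linear sets in this way form a Boolean algebra containing the elementary
   regions, so polyhedral sets and their complements are disjoint unions of free
   linear sets. Conversely every linear set is a union of free ones (use up an
   integral relation among the generators), and free ones are polyhedral by
   inverting the matrix of generators over Q. Hence semilinear subsets of Z^n
   are closed under complement as well as projection.

   In G, all the sets {z | iota z * g \in U} are semilinear as soon as U is
   rational: products only involve conjugation by coset representatives, and the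
   submonoid generated by U is read off a finite graph on coset representatives
   by state elimination. A formula becomes, for each choice of cosets of its
   variables, a semilinear condition on integer coordinates. *)

Set Implicit Arguments.
Unset Strict Implicit.
Unset Printing Implicit Defensive.

Import Order.TTheory GRing.Theory Num.Theory.
Local Open Scope classical_set_scope.
Local Open Scope ring_scope.

(** * Integer combinations and linear sets *)

Section FiniteUnions.
Context {T : Type}.
Implicit Types (C : set (set T)) (X Y : set T).

Lemma bigcup_ord0 (Y : 'I_0 -> set T) : \bigcup_i Y i = set0.
Proof. by apply/seteqP; split=> z // [[]]. Qed.

Lemma bigcup_ordS r (Y : 'I_r.+1 -> set T) :
  \bigcup_i Y i = Y ord0 `|` \bigcup_i Y (lift ord0 i).
Proof.
apply/seteqP; split=> z; last by case=> [|[i _]] ?; [exists ord0|exists (lift ord0 i)].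
case=> i _; case: (unliftP ord0 i) => [j|] -> Yz; first by right; exists j.
by left.
Qed.

Lemma bigcup_split r s (Y : 'I_r -> set T) (Z : 'I_s -> set T) :
  \bigcup_i Y i `|` \bigcup_i Z i =
  \bigcup_(i in @setT 'I_(r + s))
     match fintype.split i with inl j => Y j | inr j => Z j end.
Proof.
apply/seteqP; split=> z; last by case=> i _; case: fintype.split => j; [left|right]; exists j.
case=> -[i _ iz]; first by exists (lshift s i) => //; rewrite (unsplitK (inl i)).
by exists (rshift r i) => //; rewrite (unsplitK (inr i)).
Qed.

Lemma finite_union0 C : finite_union C set0.
Proof. by exists 0%N, (fun=> set0); split=> [[]|] //; rewrite bigcup_ord0. Qed.

Lemma finite_union1 C X : C X -> finite_union C X.
Proof.
move=> CX; exists 1%N, (fun=> X); split=> //.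
by rewrite bigcup_ordS bigcup_ord0 setU0.
Qed.

Lemma finite_unionU C X Y :
  finite_union C X -> finite_union C Y -> finite_union C (X `|` Y).
Proof.
case=> r [F [CF ->]] [s [G [CG ->]]]; rewrite bigcup_split.
eexists; eexists; split; last reflexivity.
by move=> i /=; case: fintype.split.
Qed.

Lemma finite_union_ord C r (Y : 'I_r -> set T) :
  (forall i, finite_union C (Y i)) -> finite_union C (\bigcup_i Y i).
Proof.
elim: r Y => [|r IH] Y CY; first by rewrite bigcup_ord0; apply: finite_union0.
by rewrite bigcup_ordS; apply: finite_unionU => //; apply: IH.
Qed.

Lemma finite_union_seq C (I : eqType) (s : seq I) (Y : I -> set T) :
  (forall i, i \in s -> finite_union C (Y i)) ->
  finite_union C [set z | exists2 i, i \in s & Y i z].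
Proof.
elim: s => [|j s IH] CY.
  rewrite (_ : [set z | _] = set0); first exact: finite_union0.
  by apply/seteqP; split=> z // [].
rewrite (_ : [set z | _] = Y j `|` [set z | exists2 i, i \in s & Y i z]).
  apply: finite_unionU; first exact: CY (mem_head _ _).
  by apply: IH => i si; apply: CY; rewrite inE si orbT.
apply/seteqP; split=> z.
  by move=> [i]; rewrite inE => /orP[/eqP->|]; [left|right; exists i].
by case=> [Yz|[i si Yz]]; [exists j; rewrite ?mem_head|exists i; rewrite // inE si orbT].
Qed.

Lemma finite_union_and C (P : Prop) X :
  finite_union C X -> finite_union C [set z | P /\ X z].
Proof.
move=> CX; have [HP|nP] := pselect P.
  by rewrite (_ : [set z | _] = X) //; apply/seteqP; split=> z // [].
rewrite (_ : [set z | _] = set0); first exact: finite_union0.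
by apply/seteqP; split=> z // [].
Qed.

Lemma finite_union_sub C C' X :
  (forall Y, C Y -> finite_union C' Y) -> finite_union C X -> finite_union C' X.
Proof. by move=> CC' [r [Y [CY ->]]]; apply: finite_union_ord => i; apply: CC'. Qed.

Lemma finite_inter1 C X : C X -> finite_inter C X.
Proof.
move=> CX; exists 1%N, (fun=> X); split=> //.
by rewrite -[RHS]setCK setC_bigcap bigcup_ordS bigcup_ord0 setU0 setCK.
Qed.

Lemma finite_interI C X Y :
  finite_inter C X -> finite_inter C Y -> finite_inter C (X `&` Y).
Proof.
case=> r [F [CF ->]] [s [G [CG ->]]].
exists (r + s)%N, (fun i => match fintype.split i with inl j => F j | inr j => G j end).
split; first by move=> i /=; case: fintype.split.
rewrite -[RHS]setCK -[LHS]setCK setCI !setC_bigcap bigcup_split; congr (~` _).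
by congr (\bigcup_(_ in _) _); apply/funext => i; case: fintype.split.
Qed.

Lemma finite_interT C : finite_inter C setT.
Proof. by exists 0%N, (fun=> set0); split=> [[]|] //; apply/seteqP; split=> z // _ []. Qed.

Lemma finite_inter_ord C r (Y : 'I_r -> set T) :
  (forall i, finite_inter C (Y i)) -> finite_inter C (\bigcap_i Y i).
Proof.
elim: r Y => [|r IH] Y CY.
  rewrite -[\bigcap_i _]setCK setC_bigcap bigcup_ord0 setC0; exact: finite_interT.
rewrite -[\bigcap_i _]setCK setC_bigcap bigcup_ordS setCU setCK setC_bigcup.
under eq_bigcapr do rewrite setCK.
by apply: finite_interI => //; apply: IH.
Qed.

End FiniteUnions.

(** Coefficients are total functions on [nat], so that lists of generators can grow, shrink and be
    permuted without dependent types. Only the values below [size B] matter. *)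
Fixpoint comb (V : zmodType) (f : nat -> int) (B : seq V) : V :=
  if B is b :: B' then b *~ f 0%N + comb (fun i => f i.+1) B' else 0.

Definition consf (x : int) (f : nat -> int) : nat -> int :=
  fun i => if i is j.+1 then f j else x.

Definition catf (n : nat) (f g : nat -> int) : nat -> int :=
  fun i => if (i < n)%N then f i else g (i - n)%N.

Lemma catfl n f g i : (i < n)%N -> catf n f g i = f i.
Proof. by rewrite /catf => ->. Qed.

Lemma catfr n f g i : catf n f g (n + i)%N = g i.
Proof. by rewrite /catf ltnNge leq_addr /= addKn. Qed.

Definition lin (V : zmodType) (a : V) (B : seq V) : set V :=
  [set z | exists f, (forall i, 0 <= f i) /\ z = a + comb f B].

(** Linear independence over the integers, for lists: a repeated vector already counts as a
    dependence. *)
Definition zfree (V : zmodType) (B : seq V) : Prop :=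
  forall f, comb f B = 0 -> forall i, (i < size B)%N -> f i = 0.

Section Combinations.
Context {V : zmodType}.
Implicit Types (a b c z : V) (B : seq V) (f g : nat -> int).

Lemma eq_comb f g B :
  (forall i, (i < size B)%N -> f i = g i) -> comb f B = comb g B.
Proof.
elim: B f g => //= b B IH f g fg.
by rewrite fg //; congr (_ + _); apply: IH => i iB; apply: fg.
Qed.

Lemma combD f g B : comb (fun i => f i + g i) B = comb f B + comb g B.
Proof.
elim: B f g => [|b B IH] f g /=; first by rewrite addr0.
by rewrite mulrzDr IH addrACA.
Qed.

Lemma combZ f B (x : int) : comb (fun i => f i * x) B = comb f B *~ x.
Proof.
elim: B f => [|b B IH] f /=; first by rewrite mul0rz.
by rewrite IH mulrzDl mulrzA.
Qed.

Lemma combN f B : comb (fun i => - f i) B = - comb f B.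
Proof.
rewrite -mulrN1z -combZ; apply: eq_comb => i _; by rewrite mulrN1.
Qed.

Lemma comb0 B : comb (fun=> 0) B = 0.
Proof. by elim: B => //= b B ->; rewrite mulr0z addr0. Qed.

Lemma comb_cat f B1 B2 :
  comb f (B1 ++ B2) = comb f B1 + comb (fun i => f (size B1 + i)%N) B2.
Proof.
elim: B1 f => [|b B1 IH] f /=; first by rewrite add0r.
by rewrite IH addrA.
Qed.

Lemma comb_catf f g B1 B2 :
  comb (catf (size B1) f g) (B1 ++ B2) = comb f B1 + comb g B2.
Proof.
rewrite comb_cat; congr (_ + _); apply: eq_comb => i ilt; first exact: catfl.
exact: catfr.
Qed.

Lemma comb_map (W : zmodType) (h : {additive V -> W}) f B :
  h (comb f B) = comb f (map h B).
Proof.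
elim: B f => [|b B IH] f /=; first by rewrite raddf0.
by rewrite raddfD raddfMz IH.
Qed.

Lemma comb_sum f B : comb f B = \sum_(i < size B) B`_i *~ f i.
Proof.
elim: B f => [|b B IH] f /=; first by rewrite big_ord0.
by rewrite big_ord_recl IH.
Qed.

Lemma lin_nil a : lin a [::] = [set a].
Proof.
apply/seteqP; split=> z /=; first by case=> f [_ ->]; rewrite addr0.
by move=> ->; exists (fun=> 0); rewrite addr0.
Qed.

Lemma lin_consP a b B z :
  lin a (b :: B) z <-> exists x : int, 0 <= x /\ lin (a + b *~ x) B z.
Proof.
split=> [[f [f0 ->]]|[x [x0 [f [f0 ->]]]]].
  by exists (f 0%N); split=> //; exists (fun i => f i.+1); rewrite addrA.
exists (consf x f); split; last by rewrite addrA.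
by case.
Qed.

Lemma lin_base a B : lin a B a.
Proof. by exists (fun=> 0); rewrite comb0 addr0. Qed.

Lemma lin_catP a B1 B2 z :
  lin a (B1 ++ B2) z <-> exists x y, [/\ lin 0 B1 x, lin 0 B2 y & z = a + x + y].
Proof.
split=> [[f [f0 ->]]|[_ [_ [[f [f0 ->]] [g [g0 ->]] ->]]]].
  exists (comb f B1), (comb (fun i => f (size B1 + i)%N) B2).
  split; last by rewrite comb_cat addrA.
    by exists f; rewrite add0r.
  by exists (fun i => f (size B1 + i)%N); rewrite add0r.
exists (catf (size B1) f g); split; last by rewrite comb_catf !add0r addrA.
by move=> i; rewrite /catf; case: ifP.
Qed.

Lemma lin_perm a B1 B2 : perm_eq B1 B2 -> lin a B1 = lin a B2.
Proof.
apply: catCA_perm_subst => s1 s2 s3; apply/seteqP.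
wlog suff : s1 s2 / lin a (s1 ++ s2 ++ s3) `<=` lin a (s2 ++ s1 ++ s3).
  by move=> H; split; apply: H.
move=> z /lin_catP[x [w [s1x /lin_catP[y [v [s2y s3v ->]]] ->]]].
apply/lin_catP; exists y, (x + v); split=> //; last first.
  by rewrite add0r !addrA; congr (_ + _); rewrite addrAC.
by apply/lin_catP; exists x, v; rewrite add0r.
Qed.

Lemma zfree_cat B1 B2 :
  zfree (B1 ++ B2) <->
  forall f g, comb f B1 + comb g B2 = 0 ->
    (forall i, (i < size B1)%N -> f i = 0) /\
    (forall i, (i < size B2)%N -> g i = 0).
Proof.
split=> [fr f g|fr f].
  rewrite -comb_catf => /fr H; split=> i ilt.
    by have := H i; rewrite catfl // size_cat ltn_addr //; exact.
  by have := H (size B1 + i)%N; rewrite catfr size_cat ltn_add2l; exact.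
rewrite comb_cat => /fr[H1 H2] i; rewrite size_cat => ilt.
have [/H1//|le] := ltnP i (size B1).
by have := H2 (i - size B1)%N; rewrite subnKC //; apply; lia.
Qed.

Lemma zfree_perm B1 B2 : perm_eq B1 B2 -> zfree B1 -> zfree B2.
Proof.
apply: catCA_perm_ind => s1 s2 s3 /zfree_cat fr.
apply/zfree_cat => f g; rewrite comb_cat => fg0.
have /fr[H1 H23] : comb g s1 +
    comb (catf (size s2) f (fun i => g (size s1 + i)%N)) (s2 ++ s3) = 0.
  by rewrite comb_catf addrCA.
split=> i ilt.
  by have := H23 i; rewrite catfl // size_cat ltn_addr //; exact.
have [/H1//|le] := ltnP i (size s1).
have := H23 (size s2 + (i - size s1))%N; rewrite catfr.
by rewrite subnKC //; apply; rewrite !size_cat ltn_add2l ltn_subLR // in ilt *.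
Qed.

Lemma zfree_cons b B : zfree (b :: B) -> zfree B.
Proof.
move=> fr f f0 i ilt; apply: (fr (consf 0 f) _ i.+1) => //=.
by rewrite mulr0z add0r.
Qed.

Lemma zfree_mulz b B (m : int) : m != 0 -> zfree (b :: B) -> zfree (b *~ m :: B).
Proof.
move=> m0 fr f f0.
have H : comb (consf (m * f 0%N) (fun i => f i.+1)) (b :: B) = 0.
  by rewrite /= mulrzA.
case=> [_|i ilt]; last exact: (fr _ H i.+1).
by have /eqP := fr _ H 0%N isT; rewrite mulf_eq0 (negPf m0) => /eqP.
Qed.

Lemma zfree_shear b c B : zfree (b :: c :: B) -> zfree (b :: b + c :: B).
Proof.
move=> fr f f0.
have H : comb (consf (f 0%N + f 1%N) (fun i => f i.+1)) (b :: c :: B) = 0.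
  by rewrite -[RHS]f0 /= mulrzDr mulrzDl !addrA.
have H1 := fr _ H 1%N isT.
case=> [_|i ilt]; last exact: (fr _ H i.+1).
by have := fr _ H 0%N isT; rewrite /= (H1 : f 1%N = 0) addr0.
Qed.

Lemma zfree_inj f g B : zfree B -> comb f B = comb g B ->
  forall i, (i < size B)%N -> f i = g i.
Proof.
move=> fr fg i ilt; apply/eqP; rewrite -subr_eq0; apply/eqP.
by apply: (fr (fun i => f i + - g i)) => //; rewrite combD combN fg subrr.
Qed.

Lemma zfreeN b B : zfree (b :: B) -> zfree (- b :: B).
Proof. by rewrite -(mulrN1z b); apply: zfree_mulz. Qed.

End Combinations.

(** * Disjoint decompositions into free linear sets *)

(** Disjointness is recorded one piece at a time, each piece against the union of those added before
    it. Every later construction of disjoint unions proceeds by induction on this. *)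
Inductive dlin (V : zmodType) : set V -> Prop :=
| dlin0 : dlin set0
| dlinS a B X : zfree B -> dlin X -> (forall z, lin a B z -> ~ X z) ->
    dlin (lin a B `|` X).

Section DisjointLinear.
Context {V : zmodType}.
Implicit Types (a b c z : V) (B : seq V) (X Y : set V) (u : {additive V -> int}).

Lemma mulrz1D b (x : int) : b *~ (1 + x) = b + b *~ x.
Proof. by rewrite mulrzDr mulr1z. Qed.

(** The coefficient of [b] is either zero or at least one. Independence makes this coefficient a
    function of the point, hence the disjointness. *)
Lemma lin_split_zero a b B :
  zfree (b :: B) ->
  lin a (b :: B) = lin a B `|` lin (a + b) (b :: B) /\
  (forall z, lin a B z -> ~ lin (a + b) (b :: B) z).
Proof.
move=> fr; split; last first.
  move=> z [f [f0 ->]] /lin_consP[x [x0 [g [g0]]]].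
  rewrite -!addrA => /addrI; rewrite addrA -mulrz1D => E.
  have /(_ 0%N isT)/= : forall i, (i < (size B).+1)%N ->
      consf 0 f i = consf (1 + x) g i.
    by apply: (zfree_inj fr); rewrite /= mulr0z add0r.
  by lia.
apply/seteqP; split=> z.
  move=> /lin_consP[x [x0 zx]]; have [xE|xn0] := eqVneq x 0.
    by left; rewrite xE mulr0z addr0 in zx.
  right; apply/lin_consP; exists (x - 1); split; first by lia.
  by rewrite -addrA -mulrz1D [1 + _]addrC subrK.
case=> [zB|/lin_consP[x [x0 zx]]]; apply/lin_consP.
  by exists 0; rewrite mulr0z addr0.
exists (1 + x); split; first by lia.
by rewrite mulrz1D addrA.
Qed.

(** Euclidean division of the coefficient of [b] by [m]: the remainder goes into the base point, the
    quotient becomes the coefficient of the multiple of [b]. By independence a point determines its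
    remainder. *)
Lemma lin_split_mod a b B (m : nat) : (0 < m)%N -> zfree (b :: B) ->
  let Y (r : nat) := lin (a + b *~ r%:Z) (b *~ m%:Z :: B) in
  lin a (b :: B) = [set z | exists r, (r < m)%N /\ Y r z] /\
  (forall r s z, (r < m)%N -> (s < m)%N -> Y r z -> Y s z -> r = s).
Proof.
move=> m0 fr Y; split; last first.
  move=> r s z rm sm /lin_consP[x [x0 [f [f0 ->]]]] /lin_consP[y [y0 [g [g0]]]].
  rewrite -!addrA => /addrI; rewrite !addrA -!mulrzA -!mulrzDr => E.
  have /(_ 0%N isT)/= : forall i, (i < (size B).+1)%N ->
      consf (r%:Z + m%:Z * x) f i = consf (s%:Z + m%:Z * y) g i.
    exact: (zfree_inj fr).
  move=> {}E; have : (r%:Z + m%:Z * x = s%:Z + m%:Z * y %[mod m])%Z by rewrite E.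
  rewrite ![m%:Z * _]mulrC !(addrC (Posz _)) !modzMDl !modz_small; by lia.
apply/seteqP; split=> z.
  move=> /lin_consP[x [x0 zx]].
  exists `|(x %% m%:Z)%Z|%N; have m0' : m%:Z != 0 by lia.
  have H1 := modz_ge0 x m0'; have H2 := ltz_pmod x (_ : 0 < m%:Z).
  have {}H2 : (x %% m%:Z)%Z < m%:Z by apply: H2; lia.
  split; first by lia.
  apply/lin_consP; exists (x %/ m%:Z)%Z; split; first by rewrite divz_ge0; lia.
  rewrite -addrA -mulrzA -mulrzDr gez0_abs //.
  by rewrite [X in b *~ X]addrC [m%:Z * _]mulrC -divz_eq.
move=> [r [rm /lin_consP[x [x0 zx]]]]; apply/lin_consP.
exists (r%:Z + m%:Z * x); split; first by nia.
by rewrite mulrzDr mulrzA addrA.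
Qed.

(** If y <= x then xb + yc = (x-y)b + y(b+c); otherwise it equals c + (y-x-1)c + x(b+c). The extra
    [c] in the second base point encodes the strict inequality and keeps the two pieces apart. *)
Lemma lin_split_pair a b c B : zfree (b :: c :: B) ->
  lin a (b :: c :: B) = lin a (b :: b + c :: B) `|` lin (a + c) (c :: b + c :: B) /\
  (forall z, lin a (b :: b + c :: B) z -> ~ lin (a + c) (c :: b + c :: B) z).
Proof.
move=> fr; split; last first.
  move=> z /lin_consP[x [x0 /lin_consP[y [y0 [f [f0 ->]]]]]].
  move=> /lin_consP[x' [x'0 /lin_consP[y' [y'0 [g [g0]]]]]] E.
  have H : comb (consf (x + y) (consf y f)) (b :: c :: B) =
           comb (consf y' (consf (1 + x' + y') g)) (b :: c :: B).
    apply: (addrI a); rewrite /= mulrzDr !addrA.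
    move: E; rewrite !mulrzDl !addrA => ->; rewrite !mulrzDr mulr1z !addrA.
    by rewrite (addrAC a (b *~ y') c) (addrAC _ (b *~ y') (c *~ x')).
  have := zfree_inj fr H; move=> H01.
  have := H01 0%N isT; have := H01 1%N isT; rewrite /=; lia.
apply/seteqP; split=> z.
  move=> /lin_consP[x [x0 /lin_consP[y [y0 [f [f0 ->]]]]]].
  have [yx|xy] := lerP y x.
    left; apply/lin_consP; exists (x - y); split; first by lia.
    apply/lin_consP; exists y; split=> //; exists f; split=> //.
    congr (_ + _); rewrite -!addrA; congr (a + _).
    by rewrite mulrzBr mulrzDl addrA subrK.
  right; apply/lin_consP; exists (y - x - 1); split; first by lia.
  apply/lin_consP; exists x; split=> //; exists f; split=> //.
  have -> : c *~ y = c + c *~ (y - x - 1) + c *~ x.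
    by rewrite -mulrz1D -mulrzDr; congr (_ *~ _); ring.
  rewrite mulrzDl !addrA; congr (_ + _ + _).
  by rewrite (addrAC a (b *~ x) c) (addrAC _ (b *~ x)).
case=> /lin_consP[x [x0 /lin_consP[y [y0 [f [f0 ->]]]]]].
  apply/lin_consP; exists (x + y); split; first by lia.
  apply/lin_consP; exists y; split=> //; exists f; split=> //.
  by congr (_ + _); rewrite mulrzDl mulrzDr !addrA.
apply/lin_consP; exists y; split=> //.
apply/lin_consP; exists (1 + x + y); split; first by lia.
exists f; split=> //; rewrite mulrzDl !mulrzDr mulr1z !addrA.
by rewrite (addrAC a (b *~ y) c) (addrAC _ (b *~ y) (c *~ x)).
Qed.

Lemma dlin_lin a B : zfree B -> dlin (lin a B).
Proof. by move=> fr; rewrite -[lin a B]setU0; apply: dlinS fr (dlin0 V) _ => z _ []. Qed.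

Lemma dlinU X Y : dlin X -> dlin Y -> (forall z, X z -> ~ Y z) -> dlin (X `|` Y).
Proof.
move=> dX dY; elim: dX => [|a B {}X fr dX IH dis] XY; first by rewrite set0U.
rewrite -setUA; apply: dlinS => //.
  by apply: IH => z Xz; apply: XY; right.
by move=> z zB [/(dis _ zB)//|]; apply: XY; left.
Qed.

Lemma dlin_bigcup (m : nat) (Y : nat -> set V) :
  (forall r, dlin (Y r)) ->
  (forall r s z, (r < m)%N -> (s < m)%N -> Y r z -> Y s z -> r = s) ->
  dlin [set z | exists r, (r < m)%N /\ Y r z].
Proof.
move=> dY; elim: m => [|m IH] dis.
  rewrite (_ : [set z | _] = set0); first exact: dlin0.
  by apply/seteqP; split=> z // [r []].
rewrite (_ : [set z | _] = [set z | exists r, (r < m)%N /\ Y r z] `|` Y m).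
  apply: dlinU => //.
    by apply: IH => r s z rm sm; apply: dis; rewrite ltnS ltnW.
  move=> z [r [rm Yr]] Ym; have := dis r m z; rewrite !ltnS (ltnW rm) leqnn.
  by move=> /(_ isT isT Yr Ym) rE; rewrite rE ltnn in rm.
apply/seteqP; split=> z.
  move=> [r []]; rewrite ltnS leq_eqVlt => /orP[/eqP->|rm] Yr; first by right.
  by left; exists r.
case=> [[r [rm Yr]]|Ym]; first by exists r; rewrite ltnS ltnW.
by exists m.
Qed.

Lemma dlin_cut a B X : zfree B -> (forall z, lin a B z -> X z <-> X a) ->
  dlin (lin a B `&` X).
Proof.
move=> fr XE; have [Xa|nXa] := pselect (X a).
  rewrite (_ : _ `&` _ = lin a B); first exact: dlin_lin.
  by apply/seteqP; split=> z; [case|move=> zB; split=> //; apply/XE].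
rewrite (_ : _ `&` _ = set0); first exact: dlin0.
by apply/seteqP; split=> z // [zB /(XE _ zB)].
Qed.

Lemma lin_additive_values u (L : int) a B z :
  (forall b, b \in B -> u b = 0 \/ u b = L) -> lin a B z ->
  exists t : nat, u z = u a + L * t%:Z.
Proof.
elim: B a => [|b B IH] a uB.
  by rewrite lin_nil => ->; exists 0%N; rewrite mulr0 addr0.
move=> /lin_consP[x [x0 /IH]].
case=> [c cB|t uz]; first by apply: uB; rewrite inE cB orbT.
move: uz; rewrite raddfD raddfMz /=.
have [->|->] := uB b (mem_head _ _); first by rewrite mul0rz addr0; exists t.
move=> ->; exists (`|x| + t)%N; rewrite PoszD gez0_abs //.
by rewrite -mulrzr /= intz; ring.
Qed.

(** [K] bounds the number of steps of length [L] after which [u] is past the threshold [M], where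
    [F] no longer changes along the set. Pick a generator of value [L]: if its coefficient is zero,
    drop it (inner induction on the size); if positive, move the base point by it (outer induction
    on [K]). With no such generator, [u] is constant on the set. *)
Lemma dlin_semibounded u (F : int -> Prop) (L M : int) :
  (forall t, M <= t -> F (t + L) <-> F t) -> 0 < L ->
  forall (K : nat) B a, zfree B -> (forall b, b \in B -> u b = 0 \/ u b = L) ->
    M <= u a + L * K%:Z -> dlin (lin a B `&` [set z | F (u z)]).
Proof.
move=> FL L0; elim=> [|K IHK] B a.
  rewrite mulr0 addr0 => fr uB Ma; apply: dlin_cut => // z.
  move=> /(lin_additive_values uB)[t /= ->].
  elim: t => [|t IH]; first by rewrite mulr0 addr0.
  rewrite -IH -addn1 PoszD mulrDr mulr1 addrA; apply: FL; nia.
move: {2}(size B) (leqnn (size B)) => n; elim: n => [|n IHn] in B a *.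
  case: B => // _ fr _ _; apply: dlin_cut => // z.
  by rewrite lin_nil => ->.
move=> sB fr uB Ma; have [/hasP[b bB /eqP ub]|/hasPn nB] := boolP (has (fun b => u b == L) B).
  have pB := perm_to_rem bB; rewrite (lin_perm _ pB).
  have fr' := zfree_perm pB fr.
  have [-> dis] := lin_split_zero a fr'.
  rewrite setIUl; apply: dlinU; last by move=> z [/dis zn _] [/zn].
    apply: IHn => //; last by move=> c /mem_rem; apply: uB.
      by rewrite size_rem // -subn1 leq_subLR.
    exact: zfree_cons fr'.
  apply: IHK => //; first by move=> c; rewrite -(perm_mem pB); apply: uB.
  by rewrite raddfD /= ub; lia.
apply: dlin_cut => // z zB.
have uB0 : forall b, b \in B -> u b = 0 \/ u b = 0.
  by move=> b bB; left; case: (uB _ bB) => // ub; move: (nB _ bB); rewrite ub eqxx.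
by have [t /= ->] := lin_additive_values uB0 zB; rewrite mul0r addr0.
Qed.

Lemma le_add_mul_abs (L M w : int) : 0 < L -> M <= w + L * `|M - w|%N%:Z.
Proof. by move=> L0; have := ler_peMl (normr_ge0 (M - w)) (_ : 1 <= L); rewrite abszE; lia. Qed.

(** Induction on the number of generators with nonzero value. Two generators [p], [q] of opposite
    values are traded by [lin_split_pair] for one of them and [p + q], whose value is zero; when all
    signs agree, [dlin_semibounded] applies. *)
Lemma dlin_balanced u (F : int -> Prop) (L M : int) :
  (forall t, M <= t -> F (t + L) <-> F t) ->
  (forall t, t <= - M -> F (t - L) <-> F t) -> 0 < L ->
  forall B a, zfree B -> (forall b, b \in B -> [\/ u b = 0, u b = L | u b = - L]) ->
    dlin (lin a B `&` [set z | F (u z)]).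
Proof.
move=> FL FN L0 B; move: {2}(count _ _) (leqnn (count (fun b => u b != 0) B)) => n.
elim: n => [|n IH] in B *; move=> cB a fr uB.
  have uB0 : forall b, b \in B -> u b = 0 \/ u b = 0.
    move=> b bB; left; apply/eqP/negPn/negP => ub.
    by move: cB; rewrite leqNgt -has_count => /hasP; apply; exists b.
  apply: dlin_cut => // z /(lin_additive_values uB0)[t /= ->].
  by rewrite mul0r addr0.
have [/hasP[p pB /eqP up]|/hasPn nL] := boolP (has (fun b => u b == L) B); last first.
  (* All values are 0 or [- L]: negating [u] and reflecting [F] makes them 0 or [L], and exchanges
     the two ends of periodicity. *)
  pose u' := GRing.opp \o u.
  rewrite (_ : [set z | F (u z)] = [set z | F (- (u' z))]); last first.
    by apply/seteqP; split=> z /=; rewrite opprK.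
  apply: (@dlin_semibounded u' (fun t => F (- t)) L M _ L0 `|M - u' a|%N) => //.
  - by move=> t Mt; rewrite opprD; apply: FN; lia.
  - move=> b bB /=; case: (uB _ bB) => ub; rewrite ub ?oppr0 ?opprK; [by left| |by right].
    by move: (nL _ bB); rewrite ub eqxx.
  - exact: le_add_mul_abs.
have [/hasP[q qB /eqP uq]|/hasPn nN] := boolP (has (fun b => u b == - L) B); last first.
  apply: (dlin_semibounded FL L0 (K := `|M - u a|%N)) => //; last exact: le_add_mul_abs.
  move=> b bB; case: (uB _ bB) => ub; [by left|by right|].
  by move: (nN _ bB); rewrite ub eqxx.
have qB' : q \in rem p B.
  have := perm_mem (perm_to_rem pB) q; rewrite qB inE.
  by case: eqP => // qp; move: uq; rewrite qp up; lia.
have pB' : perm_eq B (p :: q :: rem q (rem p B)).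
  apply: perm_trans (perm_to_rem pB) _; rewrite perm_cons; exact: perm_to_rem.
set B' := rem q _ in pB'.
have fr' := zfree_perm pB' fr; rewrite (lin_perm _ pB').
have Ln0 : L != 0 by lia.
have cB' : (count (fun b => u b != 0) B' < n)%N.
  move: cB; rewrite (permP pB') /= up uq.
  by rewrite oppr_eq0 Ln0.
have uB' : forall b, b \in B' -> [\/ u b = 0, u b = L | u b = - L].
  by move=> b bB'; apply: uB; rewrite (perm_mem pB') !inE bB' !orbT.
have [-> dis] := lin_split_pair a fr'.
have upq : u (p + q) = 0 by rewrite raddfD /= up uq subrr.
rewrite setIUl; apply: dlinU; last by move=> z [/dis zn _] [/zn].
  apply: IH => //=; first by rewrite upq eqxx ?up ?uq ?oppr_eq0 Ln0.
    exact: zfree_shear.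
  move=> b; rewrite !inE => /or3P[/eqP->|/eqP->|/uB'//]; [by constructor 2|by constructor 1].
apply: IH => //=; first by rewrite upq eqxx ?up ?uq ?oppr_eq0 Ln0.
  rewrite [p + q]addrC; apply: zfree_shear.
  by apply: zfree_perm fr'; apply/permP => P /=; lia.
move=> b; rewrite !inE => /or3P[/eqP->|/eqP->|/uB'//]; [by constructor 3|by constructor 1].
Qed.

End DisjointLinear.

(** * Refining free linear sets by eventually periodic conditions *)

Section Refine.
Context {V : zmodType}.
Implicit Types (a b c z : V) (B : seq V) (X Y : set V) (u : {additive V -> int}).

(** [B1] holds the generators already normalised, [B2] those still to be treated. Each step moves
    one generator across, replaced by a multiple, at the price of a split into residues of its
    coefficient. *)
Lemma dlin_normalise u (L : int) X : 0 < L ->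
  (forall a B, zfree B -> (forall b, b \in B -> [\/ u b = 0, u b = L | u b = - L]) ->
    dlin (lin a B `&` X)) ->
  forall B2 B1 a, zfree (B1 ++ B2) ->
    (forall b, b \in B1 -> [\/ u b = 0, u b = L | u b = - L]) ->
    (forall b, b \in B2 -> u b != 0 -> (u b %| L)%Z) ->
    dlin (lin a (B1 ++ B2) `&` X).
Proof.
move=> L0 base; elim=> [|b B2 IH] B1 a fr uB1 uB2.
  by rewrite cats0 in fr *; apply: base.
have pB : perm_eq (B1 ++ b :: B2) (b :: B1 ++ B2).
  by apply/permP => P; rewrite /= !count_cat /=; lia.
rewrite (lin_perm _ pB); have {fr} fr := zfree_perm pB fr.
have [m m0 um] : exists2 m : nat, (0 < m)%N &
    [\/ u b * m%:Z = 0, u b * m%:Z = L | u b * m%:Z = - L].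
  have [->|ub] := eqVneq (u b) 0; first by exists 1%N => //; constructor 1; rewrite mul0r.
  have /dvdzP[q Lq] := uB2 b (mem_head _ _) ub.
  exists `|q|%N; first by lia.
  by have [q0|q0] := ltP 0 q; [constructor 2|constructor 3]; rewrite Lq; lia.
have [-> dis] := lin_split_mod a m0 fr.
rewrite (_ : _ `&` _ =
    [set z | exists r, (r < m)%N /\
      (lin (a + b *~ r%:Z) (b *~ m%:Z :: B1 ++ B2) `&` X) z]); last first.
  apply/seteqP; split=> z; first by case=> -[r [rm zr]] Xz; exists r.
  by case=> r [rm [zr Xz]]; split=> //; exists r.
apply: dlin_bigcup => [r|r s z rm sm [zr _] [zs _]]; last exact: dis zr zs.
rewrite -cat_cons; apply: IH.
- by apply: zfree_mulz => //; lia.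
- move=> c; rewrite inE => /orP[/eqP->|/uB1//].
  by rewrite raddfMz /= -mulrzr intz.
- by move=> c cB; apply: uB2; rewrite inE cB orbT.
Qed.

Definition eventually_periodic (F : int -> Prop) : Prop :=
  exists p M : int, [/\ 0 < p,
    forall t, M <= t -> F (t + p) <-> F t &
    forall t, t <= - M -> F (t - p) <-> F t].

Lemma eventually_periodicN (F : int -> Prop) :
  eventually_periodic F -> eventually_periodic (fun t => ~ F t).
Proof.
case=> p [M [p0 F1 F2]]; exists p, M; split=> // t tM.
  by have := F1 t tM; tauto.
by have := F2 t tM; tauto.
Qed.

Lemma dlin_eventually_periodic u (F : int -> Prop) a B :
  eventually_periodic F -> zfree B -> dlin (lin a B `&` [set z | F (u z)]).
Proof.
case=> p [M [p0 F1 F2]] fr.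
(* [p * N] is a multiple of the period and divisible by every nonzero value of [u] on [B], so it can
   serve as the common step [L]. *)
pose N := (\prod_(b <- B | u b != 0) `|u b|%N)%N.
have N0 : (0 < N)%N by apply: prodn_cond_gt0 => b ub; lia.
have L0 : 0 < p * N%:Z by nia.
have F1n (n : nat) t : M <= t -> F (t + p * n%:Z) <-> F t.
  elim: n => [|n IH] Mt; first by rewrite mulr0 addr0.
  rewrite -IH // -addn1 PoszD mulrDr mulr1 addrA; apply: F1; nia.
have F2n (n : nat) t : t <= - M -> F (t - p * n%:Z) <-> F t.
  elim: n => [|n IH] Mt; first by rewrite mulr0 subr0.
  rewrite -IH // -addn1 PoszD mulrDr mulr1 opprD addrA; apply: F2; nia.
apply: (@dlin_normalise u (p * N%:Z) _ L0 _ B [::]) => //.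
  by move=> a' B'; apply: dlin_balanced (F1n N) (F2n N) _ _ _.
move=> b bB ub; apply: dvdz_mull; rewrite dvdzE /N /=.
by rewrite (big_rem b) //= ub dvdn_mulr.
Qed.

(* Closed under complement and intersection by construction, which is what
   makes the decompositions of polyhedral sets disjoint. *)
Definition refinable X : Prop :=
  forall a B, zfree B -> dlin (lin a B `&` X) /\ dlin (lin a B `&` ~` X).

Lemma dlin_setI X Y : refinable X -> dlin Y -> dlin (Y `&` X) /\ dlin (Y `&` ~` X).
Proof.
move=> rX; elim=> [|a B {}Y fr dY [IH1 IH2] dis]; first by rewrite !set0I; split; exact: dlin0.
rewrite !setIUl; have [H1 H2] := rX a B fr.
by split; apply: dlinU => // z [/dis zY _] [/zY].
Qed.

Lemma refinableT : refinable setT.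
Proof.
move=> a B fr; rewrite setIT setCT setI0; split; [exact: dlin_lin|exact: dlin0].
Qed.

Lemma refinableC X : refinable X -> refinable (~` X).
Proof. by move=> rX a B fr; rewrite setCK; have [] := rX a B fr. Qed.

Lemma refinableI X Y : refinable X -> refinable Y -> refinable (X `&` Y).
Proof.
move=> rX rY a B fr; have [H1 H2] := rX a B fr.
have [K1 K2] := dlin_setI rY H1; rewrite setIA; split=> //.
(* The complement of an intersection is cut into two disjoint parts, inside [X] but outside [Y], and
   outside [X]; a plain De Morgan union would overlap. *)
rewrite (_ : _ `&` _ = lin a B `&` X `&` ~` Y `|` lin a B `&` ~` X).
  by apply: dlinU => // z [[_ Xz] _] [_].
apply/seteqP; split=> z.
  move=> [zB nXY]; have [Xz|nXz] := pselect (X z); last by right.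
  by left; split=> // Yz; apply: nXY.
by case=> [[[zB Xz] nYz]|[zB nXz]]; split=> // -[].
Qed.

Lemma refinableU X Y : refinable X -> refinable Y -> refinable (X `|` Y).
Proof.
move=> rX rY; rewrite -[X]setCK -[Y]setCK -setCI.
by apply/refinableC/refinableI; apply: refinableC.
Qed.

Lemma refinable_bigcup r (Y : 'I_r -> set V) :
  (forall i, refinable (Y i)) -> refinable (\bigcup_i Y i).
Proof.
elim: r Y => [|r IH] Y rY.
  by rewrite bigcup_ord0 -setCT; apply/refinableC/refinableT.
by rewrite bigcup_ordS; apply: refinableU => //; apply: IH.
Qed.

Lemma refinable_bigcap r (Y : 'I_r -> set V) :
  (forall i, refinable (Y i)) -> refinable (\bigcap_i Y i).
Proof.
move=> rY; rewrite -[\bigcap_i _]setCK setC_bigcap; apply: refinableC.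
by apply: refinable_bigcup => i; apply: refinableC.
Qed.

Lemma refinable_eventually_periodic u (F : int -> Prop) :
  eventually_periodic F -> refinable [set z | F (u z)].
Proof.
move=> pF a B fr; split; first exact: dlin_eventually_periodic.
exact: (dlin_eventually_periodic u a (eventually_periodicN pF) fr).
Qed.

(** [C] carries arbitrary integer coefficients, [B] nonnegative ones. Each [c] in [C] is moved into
    [B] as [c] or as [- c], according to the sign of its coefficient; the base point [a - c] in the
    negative case prevents counting coefficient zero twice. *)
Lemma dlin_span a B C : zfree (C ++ B) ->
  dlin [set z | exists f, lin (a + comb f C) B z].
Proof.
elim: C => [|c C IH] /= in a B *.
  move=> fr; rewrite (_ : [set z | _] = lin a B); first exact: dlin_lin.
  apply/seteqP; split=> z /=; first by case=> _; rewrite addr0.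
  by move=> zB; exists (fun=> 0); rewrite addr0.
move=> fr.
have pcB : perm_eq (c :: C ++ B) (C ++ c :: B).
  by apply/permP => P; rewrite /= !count_cat /= !addnA; congr (_ + _)%N; rewrite addnC.
have fr1 := zfree_perm pcB fr.
have fr2 : zfree (C ++ - c :: B).
  apply: (@zfree_perm _ (- c :: C ++ B)); last exact: zfreeN.
  by apply/permP => P; rewrite /= !count_cat /= !addnA; congr (_ + _)%N; rewrite addnC.
rewrite (_ : [set z | _] = [set z | exists f, lin (a + comb f C) (c :: B) z] `|`
    [set z | exists f, lin (a - c + comb f C) (- c :: B) z]).
  apply: dlinU; [exact: IH|exact: IH|].
  move=> z [f /lin_consP[x [x0 [h [h0 ->]]]]] [g /lin_consP[y [y0 [k [k0]]]]].
  rewrite mulNrz => E.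
  have H : comb (consf x (catf (size C) f h)) (c :: C ++ B) =
           comb (consf (- (1 + y)) (catf (size C) g k)) (c :: C ++ B).
    apply: (addrI a); rewrite /= !comb_catf mulrNz mulrz1D opprD !addrA.
    rewrite (addrAC a (c *~ x)) E; congr (_ + _).
    by rewrite addrAC.
  by have := zfree_inj fr H (isT : (0 < size (c :: C ++ B))%N); rewrite /=; lia.
apply/seteqP; split=> z /=.
  move=> [f zB]; have [f0|f0] := lerP 0 (f 0%N).
    left; exists (fun i => f i.+1); apply/lin_consP; exists (f 0%N); split=> //.
    by rewrite -addrA [comb _ _ + _]addrC.
  (* One copy of [- c] is already in the base point, hence the coefficient [- 1 - f 0] rather than
     [- f 0]. *)
  right; exists (fun i => f i.+1); apply/lin_consP; exists (- 1 - f 0%N); split; first by lia.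
  have -> : (- c) *~ (- 1 - f 0%N) = c + c *~ f 0%N.
    by rewrite mulNrz -mulrNz opprB opprK addrC mulrz1D.
  by rewrite addrAC addrA subrK -addrA.
case=> -[f /lin_consP[x [x0 zB]]].
  by exists (consf x f); rewrite /= addrA (addrAC a).
exists (consf (- (1 + x)) f); rewrite /= mulrNz mulrz1D opprD !addrA.
by move: zB; rewrite mulNrz addrAC.
Qed.

End Refine.

(** * Linear sets as finite unions of free linear sets *)

Section LinearSets.
Context {V : zmodType}.
Implicit Types (a b z : V) (B : seq V) (X Y : set V).

Lemma lin_trans a b c B : lin a B b -> lin 0 B c -> lin a B (b + c).
Proof.
case=> f [f0 ->] [g [g0 ->]]; exists (fun i => f i + g i).
by split=> [i|]; rewrite ?addr_ge0 // combD add0r addrA.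
Qed.

Lemma lin_shift a B : lin a B = [set a + x | x in lin 0 B].
Proof.
apply/seteqP; split=> z.
  by case=> f [f0 ->]; exists (comb f B) => //; exists f; rewrite add0r.
by case=> _ [f [f0 ->]] <-; exists f; rewrite add0r.
Qed.

Lemma lin_mem B b : b \in B -> lin 0 B b.
Proof.
move=> /perm_to_rem/lin_perm->; apply/lin_consP; exists 1; split=> //.
by rewrite add0r mulr1z; apply: lin_base.
Qed.

Lemma smallest_lin B : smallest (@add_submonoid V) [set` B] = lin 0 B.
Proof.
apply/seteqP; split.
  apply: smallest_sub; last by move=> b; exact: lin_mem.
  by split; [exact: lin_base|move=> x y; exact: lin_trans].
move=> _ [f [f0 ->]] S [[S0 SD] BS]; rewrite add0r.
elim: B f f0 BS => [|b B IH] f f0 BS //=.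
apply: (SD); last first.
  by apply: IH => [i|c cB]; [exact: f0|apply: BS; rewrite /= inE; apply/orP; right].
rewrite -(gez0_abs (f0 0%N)) -pmulrn.
have Sb : S b by apply: BS; rewrite /= mem_head.
by elim: `|_|%N => // n IHn; rewrite mulrS; apply: SD.
Qed.

Lemma linear_set_lin a B : linear_set (lin a B).
Proof.
exists a, [set` B]; split; first exact: finite_seq.
by rewrite smallest_lin -lin_shift.
Qed.

Lemma linear_setP X : linear_set X -> exists a B, X = lin a B.
Proof.
case=> a [_ [/finite_seqP[B ->] ->]]; exists a, B.
by rewrite smallest_lin -lin_shift.
Qed.

Lemma set_mem_cons (T : eqType) (x : T) (s : seq T) :
  [set` x :: s] = [set x] `|` [set` s].
Proof.
apply/seteqP; split=> z /=; first by rewrite inE => /orP[/eqP->|]; [left|right].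
by rewrite inE => -[->|->]; rewrite ?eqxx ?orbT.
Qed.

Lemma dlin_semilinear X : dlin X -> semilinear_set X.
Proof.
elim=> [|a B Y fr dY sY dis]; first exact: finite_union0.
by apply: finite_unionU => //; apply/finite_union1/linear_set_lin.
Qed.

Definition free_linear X : Prop := exists a B, zfree B /\ X = lin a B.

Lemma comb_nth i f B : (i < size B)%N ->
  comb f B = B`_i *~ f i +
    comb (fun j => if (j < i)%N then f j else f j.+1) (take i B ++ drop i.+1 B).
Proof.
move=> iB; rewrite -{1}(cat_take_drop i B) (drop_nth 0 iB) !comb_cat /=.
have sz : size (take i B) = i by rewrite size_take iB.
rewrite addrCA sz addn0; congr (_ + (_ + _)); apply: eq_comb => j.
  by rewrite sz => ->.
by move=> _; rewrite /= ltnNge leq_addr /= addnS.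
Qed.

Lemma lin_drop_nth a i f B (m : nat) : (i < size B)%N -> f i = m%:Z ->
  (forall j, 0 <= f j) ->
  lin (a + B`_i *~ m%:Z) (take i B ++ drop i.+1 B) (a + comb f B).
Proof.
move=> iB fi f0; exists (fun j => if (j < i)%N then f j else f j.+1).
split; last by rewrite (comb_nth f iB) fi addrA.
by move=> j; case: ifP => _; apply: f0.
Qed.

Lemma lin_drop_nth_sub a i B (m : nat) : (i < size B)%N ->
  lin (a + B`_i *~ m%:Z) (take i B ++ drop i.+1 B) `<=` lin a B.
Proof.
move=> iB z zB.
have pB : perm_eq B (B`_i :: take i B ++ drop i.+1 B).
  by rewrite -{1}(cat_take_drop i B) (drop_nth 0 iB) perm_catC /= perm_cons perm_catC.
by rewrite (lin_perm _ pB); apply/lin_consP; exists m%:Z.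
Qed.

(* A nonnegative combination that dominates the positive part of an integral
   relation c can be lowered by c, so some coefficient i may be assumed < c i. *)
Lemma comb_reduce c B f : comb c B = 0 -> (exists i, (i < size B)%N /\ 0 < c i) ->
  (forall i, 0 <= f i) ->
  exists g i, [/\ (i < size B)%N, g i < c i, forall j, 0 <= g j & comb g B = comb f B].
Proof.
move=> c0 [i0 [i0B ci0]]; move: {2}(`|f i0|%N) (leqnn `|f i0|%N) => n.
elim: n => [|n IH] in f *.
  by move=> fn f0; exists f, i0; split=> //; have := f0 i0; lia.
move=> fn f0.
have [[i [iB fi]]|nex] := pselect (exists i, (i < size B)%N /\ f i < c i).
  by exists f, i.
have cf i : (i < size B)%N -> c i <= f i.
  by move=> iB; rewrite leNgt; apply/negP => fi; apply: nex; exists i.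
(* The lowered coefficients are set to 0 beyond [size B], because nonnegativity is required at every
   index while [c] is arbitrary there. *)
have [||g [i [iB gi g0 gE]]] := IH (fun i => if (i < size B)%N then f i - c i else 0).
- by rewrite i0B; have := cf _ i0B; lia.
- by move=> i; case: ifP => // /cf; lia.
exists g, i; split=> //; rewrite gE.
rewrite -[RHS]subr0 -c0 -combN -combD; apply: eq_comb => j jB.
by rewrite jB.
Qed.

(** Induction on the number of generators. A dependent list has, up to sign, a relation [c] with a
    positive coefficient. By [comb_reduce] every point can be written with some coefficient [i]
    below [c i]; fixing [i] and this value leaves finitely many linear sets with one generator
    fewer. The union need not be disjoint. *)
Lemma lin_free_linear a B : finite_union free_linear (lin a B).
Proof.
move: {2}(size B) (leqnn (size B)) => n; elim: n => [|n IH] in a B *.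
  by case: B => // _; apply: finite_union1; exists a, [::].
move=> sB; have [fr|nfr] := pselect (zfree B); first by apply: finite_union1; exists a, B.
have [c c0 cpos] : exists2 c, comb c B = 0 & exists i, (i < size B)%N /\ 0 < c i.
  apply: contrapT => nc; apply: nfr => f f0 i iB.
  case: (ltgtP (f i) 0) => // fi; exfalso; apply: nc.
    by exists (fun j => - f j); [rewrite combN f0 oppr0|exists i; rewrite oppr_gt0].
  by exists f => //; exists i.
rewrite (_ : lin a B = [set z | exists2 i, i \in iota 0 (size B) &
  [set z | exists2 m, m \in iota 0 `|c i| &
     [set z | 0 < c i /\ lin (a + B`_i *~ m%:Z) (take i B ++ drop i.+1 B) z] z] z]).
  apply: finite_union_seq => i; rewrite mem_iota /= => iB.
  apply: finite_union_seq => m _.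
  apply: (@finite_union_and _ _ _ (lin _ _)); apply: IH.
  rewrite size_cat size_take iB size_drop.
  by rewrite -ltnS; apply: leq_trans sB; rewrite -addnS subnSK // subnKC // ltnW.
apply/seteqP; split=> z; last first.
  move=> [i]; rewrite mem_iota /= => iB [m _ [_ zB]].
  exact: lin_drop_nth_sub zB.
case=> f [f0 ->]; have [g [i [iB gi g0 <-]]] := comb_reduce c0 cpos f0.
have gi0 := g0 i.
exists i; first by rewrite mem_iota.
exists `|g i|%N; first by rewrite mem_iota; lia.
split; first by lia.
by apply: lin_drop_nth => //; lia.
Qed.

End LinearSets.

(** * Polyhedral sets *)

Lemma dotz_is_zmod_morphism n (u : 'rV[int]_n) : zmod_morphism (dotz u).
Proof.
move=> x y; rewrite /dotz -sumrB; apply: eq_bigr => i _.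
by rewrite !mxE mulrBr.
Qed.

HB.instance Definition _ n (u : 'rV[int]_n) :=
  GRing.isZmodMorphism.Build 'rV[int]_n int (dotz u) (dotz_is_zmod_morphism u).

Lemma row_sum_mulrz n (z : 'rV[int]_n) : z = \sum_i delta_mx 0 i *~ z 0 i.
Proof.
rewrite {1}(row_sum_delta z); apply: eq_bigr => i _.
by rewrite -[z 0 i in LHS]intz scaler_int.
Qed.

(** Bundles a map shown to be additive in the middle of a proof, so that results on additive maps
    apply to it. *)
Definition additive_of (U V : zmodType) (h : U -> V) (hB : zmod_morphism h) :
    {additive U -> V} :=
  HB.pack h (GRing.isZmodMorphism.Build U V h hB).

(** An additive functional is determined by its values on the standard basis. Elementary regions can
    therefore be given by any such functional, for instance an entry of a matrix product. *)
Lemma additive_dotz n (p : {additive 'rV[int]_n -> int}) : exists u, p =1 dotz u.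
Proof.
exists (\row_i p (delta_mx 0 i)) => z.
rewrite {1}(row_sum_mulrz z) raddf_sum; apply: eq_bigr => i _.
by rewrite raddfMz mxE mulrzz.
Qed.

Section Elementary.
Context {n : nat}.
Implicit Types (a z : 'rV[int]_n) (p : {additive 'rV[int]_n -> int}).

Lemma elementary_eq p (t : int) : elementary [set z | p z = t].
Proof.
have [u pu] := additive_dotz p.
rewrite (_ : [set z | _] = [set z | dotz u z = t]); first exact: Elem_eq.
by apply/seteqP; split=> z /=; rewrite pu.
Qed.

Lemma elementary_ge p (t : int) : elementary [set z | t <= p z].
Proof.
have [u pu] := additive_dotz p.
rewrite (_ : [set z | _] = [set z | t - 1 < dotz u z]); first exact: Elem_gt.
by apply/seteqP; split=> z /=; rewrite pu; lia.
Qed.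

Lemma elementary_dvd p (t : int) (d : nat) : elementary [set z | (d%:Z %| p z - t)%Z].
Proof.
have [u pu] := additive_dotz p.
rewrite (_ : [set z | _] = [set z | (dotz u z = t %[mod d%:Z])%Z]); first exact: Elem_mod.
by apply/seteqP; split=> z /=; rewrite pu -eqz_mod_dvd => /eqP.
Qed.

End Elementary.

Lemma eventually_periodic_dvd (t : int) (d : nat) : (0 < d)%N ->
  eventually_periodic (fun s => (s = t %[mod d%:Z])%Z).
Proof.
move=> d0; exists d%:Z, 0; split=> // s _; first by rewrite modzDr.
by rewrite -[in X in _ <-> X](subrK d%:Z s) modzDr.
Qed.

Lemma eventually_periodic_eq (t : int) : eventually_periodic (fun s => s = t).
Proof. by exists 1, (`|t| + 1); split=> // s; lia. Qed.

Lemma eventually_periodic_gt (t : int) : eventually_periodic (fun s => t < s).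
Proof. by exists 1, (`|t| + 2); split=> // s; lia. Qed.

Lemma refinable_polyhedral n (X : set 'rV[int]_n) : polyhedral_set X -> refinable X.
Proof.
case=> r [Y [HY ->]]; apply: refinable_bigcup => i.
have [s [Z [HZ ->]]] := HY i; apply: refinable_bigcap => {HY}j.
case: (HZ j) => [u t|u t [|d]|u t].
- exact: (refinable_eventually_periodic (dotz u) (eventually_periodic_eq t)).
(* Modulus 0: the congruence is an equality and has no positive period of its own. *)
- rewrite (_ : [set z | _] = [set z | dotz u z = t]).
    exact: (refinable_eventually_periodic (dotz u) (eventually_periodic_eq t)).
  by apply/seteqP; split=> z /=; rewrite !modz0.
- exact: (refinable_eventually_periodic (dotz u) (eventually_periodic_dvd t (ltn0Sn d))).
- exact: (refinable_eventually_periodic (dotz u) (eventually_periodic_gt t)).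
Qed.

Lemma comb_enum (V : zmodType) n (e : 'I_n -> V) f :
  comb f (map e (enum 'I_n)) = \sum_(i < n) e i *~ f i.
Proof.
elim: n e f => [|n IH] e f; first by rewrite big_ord0 enum_ord0.
by rewrite enum_ordSl big_ord_recl /= -map_comp IH.
Qed.

(** [dlin_span] for the standard basis and no further generators: the space is cut into disjoint
    orthants. Refining this decomposition handles all polyhedral sets. *)
Lemma dlin_setT n : dlin [set: 'rV[int]_n].
Proof.
pose C := [seq (delta_mx 0 i : 'rV[int]_n) | i <- enum 'I_n].
have combC (f : nat -> int) : comb f C = \row_(i < n) f i.
  rewrite comb_enum [RHS]row_sum_mulrz; apply: eq_bigr => i _.
  by rewrite mxE.
have fr : zfree (C ++ [::]).
  rewrite cats0 => f; rewrite combC => /rowP f0 i.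
  by rewrite size_map size_enum_ord => ilt; have := f0 (Ordinal ilt); rewrite !mxE.
have := dlin_span 0 fr; rewrite (_ : [set z | _] = setT) //.
apply/seteqP; split=> // z _.
exists (fun i => if insub i is Some j then z 0 j else 0).
rewrite lin_nil add0r combC; apply/rowP => i; rewrite mxE.
by rewrite insubT //= => ilt; congr (z 0 _); apply: val_inj.
Qed.

Lemma polyhedral_dlin n (X : set 'rV[int]_n) :
  polyhedral_set X -> dlin X /\ dlin (~` X).
Proof.
move=> /refinable_polyhedral rX.
by have := dlin_setI rX (dlin_setT n); rewrite !setTI.
Qed.

(** * Free linear sets are polyhedral *)

Lemma map_intmx_inj m n :
  injective (map_mx intr : 'M[int]_(m, n) -> 'M[rat]_(m, n)).
Proof.
move=> A B /matrixP AB; apply/matrixP => i j.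
by apply: (@intr_inj rat); have := AB i j; rewrite !mxE.
Qed.

Lemma clear_denominators m n (A : 'M[rat]_(m, n)) :
  exists (d : int) (C : 'M[int]_(m, n)), 0 < d /\ map_mx intr C = d%:~R *: A.
Proof.
pose d := \prod_(p : 'I_m * 'I_n) denq (A p.1 p.2).
exists d, (\matrix_(i, j) numq (d%:~R * A i j)); split.
  by apply: prodr_gt0 => p _; apply: denq_gt0.
apply/matrixP => i j; rewrite !mxE; apply: numqK.
have -> : A i j = (numq (A i j))%:~R / (denq (A i j))%:~R by rewrite divq_num_den.
rewrite mulrA -intrM; apply: Qint_dvdz; apply: dvdz_mulr.
by rewrite /d (bigD1 (i, j)) //= dvdz_mulr.
Qed.

Section FreeLinearPolyhedral.
Context {n : nat}.
Implicit Types (a z : 'rV[int]_n) (B : seq 'rV[int]_n).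

Lemma comb_mulmx f B :
  comb f B = (\row_(i < size B) f i) *m (\matrix_(i < size B) B`_i).
Proof.
rewrite comb_sum mulmx_sum_row; apply: eq_bigr => i _.
by rewrite mxE rowK -[f i in RHS]intz scaler_int.
Qed.

(** Clearing the denominators of a rational row vector killed by the generator matrix gives an
    integral relation, so the matrix has independent rows over the rationals. Its rational right
    inverse, cleared of denominators, is [C]. *)
Lemma zfree_inverse B : zfree B ->
  exists (d : int) (C : 'M[int]_(n, size B)), 0 < d /\ (\matrix_(i < size B) B`_i) *m C = d%:M.
Proof.
set M : 'M[int]_(size B, n) := \matrix_i _ => fr.
have /row_freeP[D MD] : row_free (map_mx intr M : 'M[rat]_(size B, n)).
  apply: inj_row_free => v vM; have [d [w [d0 wE]]] := clear_denominators v.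
  have wM : w *m M = 0.
    apply: map_intmx_inj; rewrite map_mxM map_mx0 wE.
    by rewrite -scalemxAl vM scaler0.
  have w0 : w = 0.
    pose f i := if insub i is Some j then w 0 j else 0.
    have wf : \row_(i < size B) f i = w.
      apply/rowP => i; rewrite mxE /f insubT //= => ilt.
      by congr (w 0 _); apply: val_inj.
    have cf : comb f B = 0 by rewrite comb_mulmx wf.
    by rewrite -wf; apply/rowP => i; rewrite !mxE; apply: (fr f cf).
  move: wE; rewrite w0 map_mx0 => /esym/eqP; rewrite scaler_eq0 intr_eq0.
  by rewrite (gt_eqF d0) => /eqP.
have [d [C [d0 CE]]] := clear_denominators D; exists d, C; split=> //.
apply: map_intmx_inj; rewrite map_mxM CE -scalemxAr MD.
by rewrite map_scalar_mx scalemx1.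
Qed.

(** Let [M] be the matrix of generators, with M C = d. A point z has the form a + w M exactly when y
    = (z - a) C satisfies y M = d (z - a) and is divisible by d, and then w = y / d. With y >= 0
    this gives finitely many equations, inequalities and congruences. *)
Lemma lin_polyhedral a B : zfree B -> polyhedral_set (lin a B).
Proof.
move=> fr; have [d [C [d0 MC]]] := zfree_inverse fr.
set M := \matrix_(i < size B) B`_i in MC.
pose y z := (z - a) *m C.
have -> : lin a B =
    \bigcap_(j in [set: 'I_n])
      [set z : 'rV[int]_n | (z *m C *m M - d *: z) 0 j = (a *m C *m M - d *: a) 0 j]
    `&` (\bigcap_(j in [set: 'I_(size B)])
      [set z : 'rV[int]_n | (a *m C) 0 j <= (z *m C) 0 j]
    `&` \bigcap_(j in [set: 'I_(size B)])
      [set z : 'rV[int]_n | (`|d|%N%:Z %| (z *m C) ord0 j - (a *m C) ord0 j)%Z]).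
  apply/seteqP; split=> [_ [f [f0 ->]]|z [zE [z0 zd]]].
    rewrite comb_mulmx -/M; set w : 'rV[int]_(size B) := \row_i _.
    have E : (a + w *m M) *m C = a *m C + d *: w.
      by rewrite mulmxDl -mulmxA MC mul_mx_scalar.
    split=> [j _ /=|].
      by rewrite E mulmxDl scalerDr -scalemxAl opprD addrACA subrr addr0.
    have Ej j : ((a + w *m M) *m C) 0 j = (a *m C) 0 j + d * f j.
      by rewrite E mxE [(d *: w) 0 j]mxE [w 0 j]mxE.
    split=> j _ /=; rewrite Ej; first by rewrite lerDl mulr_ge0 // ltW.
    by rewrite addrAC subrr add0r gtz0_abs // dvdz_mulr.
  have yE : y z *m M = d *: (z - a).
    have : z *m C *m M - d *: z = a *m C *m M - d *: a by apply/rowP => j; apply: zE.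
    move/eqP; rewrite subr_eq => /eqP E; rewrite /y !mulmxBl scalerBr E.
    by rewrite (addrC _ (- (d *: a))) (addrAC (- (d *: a))) addrK addrC.
  have yd j : exists q, y z 0 j = d * q /\ 0 <= q.
    have := zd j I; have := z0 j I; rewrite /= -subr_ge0.
    have -> : (z *m C) 0 j - (a *m C) 0 j = y z 0 j by rewrite /y mulmxBl !mxE.
    move=> + /dvdzP[q]; rewrite gtz0_abs // => + qE; rewrite qE pmulr_lge0 // => q0.
    by exists q; rewrite mulrC.
  have [q qP] := choice yd.
  pose f i := if insub i is Some j then q j else 0.
  exists f; split; first by move=> i; rewrite /f; case: insubP => // j _ _; have [] := qP j.
  have dn0 : d != 0 by lia.
  suff : z - a = comb f B by move=> <-; rewrite addrC subrK.
  suff /rowP E : d *: (z - a) = d *: comb f B.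
    by apply/rowP => j; have := E j; rewrite [LHS]mxE [RHS]mxE => /(mulfI dn0).
  rewrite -yE comb_mulmx -/M scalemxAl; congr (_ *m _).
  apply/rowP => j; rewrite [LHS](proj1 (qP j)) !mxE /f insubT //= => jlt.
  by congr (_ * q _); apply: val_inj.
apply: finite_union1; apply: finite_interI; last apply: finite_interI.
- apply: finite_inter_ord => j; apply: finite_inter1.
  have H : zmod_morphism (fun z : 'rV[int]_n => (z *m C *m M - d *: z) 0 j).
    move=> u v; rewrite !mulmxBl scalerBr opprD addrACA -opprD.
    by rewrite [LHS]mxE; congr (_ + _); rewrite mxE.
  exact: (elementary_eq (additive_of H)).
- apply: finite_inter_ord => j; apply: finite_inter1.
  have H : zmod_morphism (fun z : 'rV[int]_n => (z *m C) 0 j).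
    by move=> u v; rewrite !mulmxBl !mxE.
  exact: (elementary_ge (additive_of H) _).
- apply: finite_inter_ord => j; apply: finite_inter1.
  have H : zmod_morphism (fun z : 'rV[int]_n => (z *m C) 0 j).
    by move=> u v; rewrite !mulmxBl !mxE.
  exact: (elementary_dvd (additive_of H) _ `|d|%N).
Qed.

End FreeLinearPolyhedral.

Lemma polyhedral_semilinear n (X : set 'rV[int]_n) :
  polyhedral_set X <-> semilinear_set X.
Proof.
split=> [/polyhedral_dlin[dX _]|]; first exact: dlin_semilinear.
apply: finite_union_sub => Y /linear_setP[a [B ->]].
apply: finite_union_sub (lin_free_linear a B) => Z [a' [B' [fr ->]]].
exact: lin_polyhedral.
Qed.

Lemma semilinearC_rV n (X : set 'rV[int]_n) :
  semilinear_set X -> semilinear_set (~` X).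
Proof.
by move=> /polyhedral_semilinear/polyhedral_dlin[_ dX]; apply: dlin_semilinear.
Qed.

(** * Closure properties of semilinear sets *)

Definition sumset (V : zmodType) (X Y : set V) : set V :=
  [set x + y | x in X & y in Y].

Definition star (V : zmodType) (X : set V) : set V :=
  smallest (@add_submonoid V) X.

Section SemilinearClosure.
Context {V : zmodType}.
Implicit Types (a b z : V) (B : seq V) (X Y : set V).

Lemma semilinear_lin a B : semilinear_set (lin a B).
Proof. exact/finite_union1/linear_set_lin. Qed.

Lemma semilinear1 a : semilinear_set [set a].
Proof. by rewrite -lin_nil; apply: semilinear_lin. Qed.

Lemma lin_image (W : zmodType) (h : {additive V -> W}) a B :
  h @` lin a B = lin (h a) (map h B).
Proof.
apply/seteqP; split=> z.
  by case=> _ [f [f0 ->]] <-; exists f; split=> //; rewrite raddfD /= comb_map.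
by case=> f [f0 ->]; exists (a + comb f B); [exists f|rewrite raddfD /= comb_map].
Qed.

Lemma semilinear_image (W : zmodType) (h : {additive V -> W}) X :
  semilinear_set X -> semilinear_set (h @` X).
Proof.
case=> r [Y [HY ->]]; rewrite image_bigcup; apply: finite_union_ord => i.
by have [a [B ->]] := linear_setP (HY i); rewrite lin_image; exact/finite_union1/linear_set_lin.
Qed.

Lemma sumset_lin a a' B B' : sumset (lin a B) (lin a' B') = lin (a + a') (B ++ B').
Proof.
apply/seteqP; split=> z.
  case=> _ [f [f0 ->]] [_ [g [g0 ->]] <-].
  exists (catf (size B) f g); rewrite comb_catf addrACA; split=> // i.
  by rewrite /catf; case: ifP.
move=> /lin_catP[_ [_ [[f [f0 ->]] [g [g0 ->]] ->]]].
exists (a + comb f B); first by exists f.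
exists (a' + comb g B'); first by exists g.
by rewrite !add0r addrACA addrA.
Qed.

Lemma semilinear_sumset X Y :
  semilinear_set X -> semilinear_set Y -> semilinear_set (sumset X Y).
Proof.
case=> r [F [HF ->]] [s [G [HG ->]]].
rewrite (_ : sumset _ _ = \bigcup_i \bigcup_j sumset (F i) (G j)).
  apply: finite_union_ord => i; apply: finite_union_ord => j.
  have [a [B ->]] := linear_setP (HF i); have [a' [B' ->]] := linear_setP (HG j).
  by rewrite sumset_lin; apply: semilinear_lin.
apply/seteqP; split=> z.
  by case=> x [i _ Fx] [y [j _ Gy] <-]; exists i => //; exists j => //; exists x => //; exists y.
by case=> i _ [j _ [x Fx [y Gy <-]]]; exists x; [exists i|exists y => //; exists j].
Qed.

Lemma semilinear_shift X b : semilinear_set X -> semilinear_set [set z | X (z + b)].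
Proof.
move=> sX; rewrite (_ : [set z | _] = sumset [set - b] X).
  by apply: semilinear_sumset => //; apply: semilinear1.
apply/seteqP; split=> z.
  by move=> Xz; exists (- b) => //; exists (z + b) => //; rewrite addrC addrK.
by case=> _ -> [y Xy <-] /=; rewrite addrAC addNr add0r.
Qed.

Lemma star0 X : star X 0.
Proof. by move=> S [[]]. Qed.

Lemma starD X x y : star X x -> star X y -> star X (x + y).
Proof. by move=> Xx Xy S XS; have [[_ SD] _] := XS; apply: SD; [apply: Xx|apply: Xy]. Qed.

Lemma sub_star X x : X x -> star X x.
Proof. by move=> Xx S [_]; apply. Qed.

Lemma star_min X (S : set V) : add_submonoid S -> X `<=` S -> star X `<=` S.
Proof. by move=> HS XS z; apply. Qed.

(** A sum of n + 1 elements of the linear set contains n + 1 copies of [a]: one is the base point,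
    the others use [a] as a further generator. Only the empty sum is left over. *)
Lemma star_lin a B : star (lin a B) = [set 0] `|` lin a (a :: B).
Proof.
apply/seteqP; split.
  apply: star_min; last first.
    by move=> z zB; right; apply/lin_consP; exists 0; rewrite mulr0z addr0.
  split; first by left.
  move=> x y [->|xB]; first by rewrite add0r.
  case=> [->|yB]; first by right; rewrite addr0.
  right; apply: lin_trans => //; move: yB => /lin_consP[t [t0 yB]].
  apply/lin_consP; exists (1 + t); split; first by lia.
  by rewrite add0r mulrz1D.
move=> z [->|]; first exact: star0.
move=> /lin_consP[t [t0 [f [f0 ->]]]].
rewrite -(gez0_abs t0) -pmulrn; elim: `|t|%N => [|n IH].
  by rewrite mulr0n addr0; apply: sub_star; exists f.
rewrite mulrS -!addrA; apply: starD; last by rewrite addrA.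
by apply: sub_star; apply: lin_base.
Qed.

(** By commutativity the summands from [X] can be collected before those from [Y], which reduces the
    star of a semilinear set to stars of linear sets. *)
Lemma starU X Y : star (X `|` Y) = sumset (star X) (star Y).
Proof.
apply/seteqP; split; last first.
  move=> _ [x Xx [y Yy <-]]; apply: starD.
    move: x Xx; apply: star_min => [|x Xx]; last by apply: sub_star; left.
    by split; [exact: star0|exact: starD].
  move: y Yy; apply: star_min => [|y Yy]; last by apply: sub_star; right.
    by split; [exact: star0|exact: starD].
apply: star_min.
  split; first by exists 0; [exact: star0|exists 0; [exact: star0|rewrite addr0]].
  move=> _ _ [x Xx [y Yy <-]] [x' Xx' [y' Yy' <-]].
  exists (x + x'); first exact: starD.
  by exists (y + y'); [exact: starD|rewrite addrACA].
move=> z [Xz|Yz].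
  by exists z; [exact: sub_star|exists 0; [exact: star0|rewrite addr0]].
by exists 0; [exact: star0|exists z; [exact: sub_star|rewrite add0r]].
Qed.

Lemma semilinear_star X : semilinear_set X -> semilinear_set (star X).
Proof.
case=> r [F [HF ->]]; elim: r F HF => [|r IH] F HF.
  rewrite bigcup_ord0 (_ : star set0 = [set 0]); first exact: semilinear1.
  apply/seteqP; split; last by move=> _ ->; exact: star0.
  by apply: star_min => // ; split=> // x y -> ->; rewrite addr0.
rewrite bigcup_ordS starU; apply: semilinear_sumset; last exact: IH.
have [a [B ->]] := linear_setP (HF ord0); rewrite star_lin.
by apply: finite_unionU; [exact: semilinear1|exact: semilinear_lin].
Qed.

End SemilinearClosure.

(* State elimination: labels of the nonempty walks from c to d in the graph
   with edge labels E, all of whose intermediate vertices lie in S. *)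
Fixpoint walks (V : zmodType) (Q : Type) (E : Q -> Q -> set V) (S : seq Q)
    (c d : Q) : set V :=
  if S is s :: S' then
    walks E S' c d `|`
    sumset (walks E S' c s) (sumset (star (walks E S' s s)) (walks E S' s d))
  else E c d.

Section Walks.
Context {V : zmodType} {Q : eqType} (E : Q -> Q -> set V).
Implicit Types (S : seq Q) (c d s : Q) (x y : V).

Lemma semilinear_walks S c d :
  (forall c d, semilinear_set (E c d)) -> semilinear_set (walks E S c d).
Proof.
move=> sE; elim: S c d => [|s S IH] c d //=.
apply: finite_unionU; first exact: IH.
apply: semilinear_sumset; first exact: IH.
by apply: semilinear_sumset; [apply: semilinear_star; exact: IH|exact: IH].
Qed.

(** Soundness of the elimination: any family containing the edges and the zero loops and stable
    under concatenation contains all labels of walks. *)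
Lemma walks_min (W : Q -> Q -> set V) S c d :
  (forall c d, E c d `<=` W c d) -> (forall c, W c c 0) ->
  (forall c s d x y, W c s x -> W s d y -> W c d (x + y)) ->
  walks E S c d `<=` W c d.
Proof.
move=> EW W0 WD; elim: S c d => [|s S IH] c d z /=; first exact: EW.
case=> [/IH//|[x /IH Wx [_ [y Wy [t /IH Wt <-]] <-]]].
apply: (WD _ _ _ _ _ Wx); apply: (WD _ _ _ _ _ _ Wt).
by move: y Wy; apply: star_min (IH s s); split=> // x' y'; apply: WD.
Qed.

Lemma sub_walks S c d : E c d `<=` walks E S c d.
Proof. by elim: S => //= s S IH z Ez; left; apply: IH. Qed.

(** Completeness of the elimination: walks may be joined at any vertex allowed as intermediate. If
    the joint is the last eliminated vertex [s0], all loops at it merge into one star. Otherwise the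
    induction joins the pieces meeting at [s]; when both walks visit [s0], the joined piece is one
    more loop at [s0]. *)
Lemma walksD S s c d x y : s \in S ->
  walks E S c s x -> walks E S s d y -> walks E S c d (x + y).
Proof.
elim: S c d x y => //= s0 S IH c d x y.
have [-> _|ss0] := eqVneq s s0; last rewrite inE (negPf ss0) /= => sS.
  (* A walk ending at [s0] is a first arrival at [s0] followed by loops; [R] below is the mirror
     image for walks starting there. *)
  have L c' w : walks E (s0 :: S) c' s0 w -> exists2 u, walks E S c' s0 u &
      exists2 v, star (walks E S s0 s0) v & w = u + v.
    case=> [w0|[u wu [_ [v wv [t wt <-]] <-]]].
      by exists w => //; exists 0; [exact: star0|rewrite addr0].
    by exists u => //; exists (v + t) => //; apply: starD => //; apply: sub_star.
  have R d' w : walks E (s0 :: S) s0 d' w -> exists2 u, walks E S s0 d' u &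
      exists2 v, star (walks E S s0 s0) v & w = v + u.
    case=> [w0|[u wu [_ [v wv [t wt <-]] <-]]].
      by exists w => //; exists 0; [exact: star0|rewrite add0r].
    exists t => //; exists (u + v); last by rewrite addrA.
    by apply: starD => //; apply: sub_star.
  move=> /L[u Wu [v Wv ->]] /R[u' Wu' [v' Wv' ->]]; right.
  exists u => //; exists (v + v' + u'); last by rewrite !addrA.
  by exists (v + v'); [exact: starD|exists u'].
case=> [Wx|[x1 Wx1 [_ [x2 Wx2 [x3 Wx3 <-]] <-]]].
  case=> [Wy|[y1 Wy1 [_ [y2 Wy2 [y3 Wy3 <-]] <-]]]; first by left; apply: IH Wx Wy.
  right; exists (x + y1); first exact: IH Wx Wy1.
  by exists (y2 + y3); [exists y2 => //; exists y3|rewrite !addrA].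
case=> [Wy|[y1 Wy1 [_ [y2 Wy2 [y3 Wy3 <-]] <-]]].
  right; exists x1 => //; exists (x2 + (x3 + y)); last by rewrite !addrA.
  by exists x2 => //; exists (x3 + y) => //; apply: IH Wx3 Wy.
right; exists x1 => //; exists (x2 + (x3 + y1) + y2 + y3); last by rewrite !addrA.
exists (x2 + (x3 + y1) + y2); last by exists y3.
by apply: starD => //; apply: starD => //; apply: sub_star; apply: IH Wx3 Wy1.
Qed.

End Walks.

(** * Rational subsets of virtually abelian groups *)

Local Open Scope group_scope.

Definition setprod (G : groupType) (X Y : set G) : set G :=
  [set x * y | x in X & y in Y].

Definition word_prod (G : groupType) (w : seq G) : G := \prod_(x <- w) x.

Section MonoidGen.
Context {G : groupType}.
Implicit Types (X Y S : set G) (x y : G).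

Lemma monoid_gen1 X : monoid_gen X 1.
Proof. by move=> S [[]]. Qed.

Lemma monoid_genM X x y : monoid_gen X x -> monoid_gen X y -> monoid_gen X (x * y).
Proof. by move=> Xx Xy S XS; have [[_ SM] _] := XS; apply: SM; [apply: Xx|apply: Xy]. Qed.

Lemma sub_monoid_gen X x : X x -> monoid_gen X x.
Proof. by move=> Xx S [_]; apply. Qed.

Lemma monoid_gen_min X S : submonoid S -> X `<=` S -> monoid_gen X `<=` S.
Proof. by move=> HS XS z; apply. Qed.

Lemma word_prod_cat (u v : seq G) : word_prod (u ++ v) = word_prod u * word_prod v.
Proof. by rewrite /word_prod big_cat. Qed.

Lemma monoid_gen_words X x :
  monoid_gen X x <-> exists2 w, (forall y, y \in w -> X y) & x = word_prod w.
Proof.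
split; last first.
  case=> w + ->; rewrite /word_prod.
  elim: w => [|y w IH] Xw; first by rewrite big_nil; apply: monoid_gen1.
  rewrite big_cons; apply: monoid_genM; first by apply: sub_monoid_gen; apply: Xw; rewrite mem_head.
  by apply: IH => z zw; apply: Xw; rewrite inE zw orbT.
move: x; apply: monoid_gen_min; last first.
  by move=> x Xx; exists [:: x]; [move=> y; rewrite inE => /eqP->|rewrite /word_prod big_seq1].
split; first by exists [::]; rewrite /word_prod ?big_nil.
move=> _ _ [u Xu ->] [v Xv ->]; exists (u ++ v); last by rewrite word_prod_cat.
by move=> y; rewrite mem_cat => /orP[/Xu|/Xv].
Qed.

End MonoidGen.

Section Rational.
Context {G : groupType} (A : set G).
Implicit Types (X Y : set G) (x y : G) (L K : set (seq G)).

Lemma word_prod_catset K L :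
  @word_prod G @` [set u ++ v | u in K & v in L] = setprod (@word_prod G @` K) (@word_prod G @` L).
Proof.
apply/seteqP; split=> z.
  case=> _ [u Ku [v Lv <-]] <-; exists (word_prod u); first by exists u.
  by exists (word_prod v); [exists v|rewrite word_prod_cat].
case=> _ [u Ku <-] [_ [v Lv <-] <-]; exists (u ++ v); last exact: word_prod_cat.
by exists u => //; exists v.
Qed.

Lemma word_prod_starset L :
  @word_prod G @` [set flatten ws | ws in [set ws : seq (seq G) | forall w, w \in ws -> L w]]
  = monoid_gen (@word_prod G @` L).
Proof.
apply/seteqP; split=> z.
  case=> _ [ws Lws <-] <-; elim: ws Lws => [|w ws IH] Lws /=.
    by rewrite /word_prod big_nil; apply: monoid_gen1.
  rewrite word_prod_cat; apply: monoid_genM.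
    by apply: sub_monoid_gen; exists w => //; apply: Lws; rewrite mem_head.
  by apply: IH => u uws; apply: Lws; rewrite inE uws orbT.
move: z; apply: monoid_gen_min; last first.
  move=> _ [w Lw <-]; exists w => //; exists [:: w]; last by rewrite /= cats0.
  by move=> u; rewrite inE => /eqP->.
split; first by exists [::]; [exists [::]|rewrite /word_prod big_nil].
move=> _ _ [_ [us Lus <-] <-] [_ [vs Lvs <-] <-].
exists (flatten us ++ flatten vs); last by rewrite word_prod_cat.
exists (us ++ vs); last by rewrite flatten_cat.
by move=> w; rewrite mem_cat => /orP[/Lus|/Lvs].
Qed.

Lemma rational0 : rational A set0.
Proof. by exists set0; split; [exact: Regular_empty|rewrite image_set0]. Qed.

Lemma rational_word (w : seq G) : (forall x, x \in w -> A x) -> rational A [set word_prod w].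
Proof.
move=> Aw; exists [set w]; split; last by rewrite (image_set1 (@word_prod G)).
elim: w Aw => [|x w IH] Aw; first exact: Regular_eps.
rewrite (_ : [set x :: w] = [set u ++ v | u in [set [:: x]] & v in [set w]]).
  apply: Regular_cat; first by apply: Regular_letter; apply: Aw; rewrite mem_head.
  by apply: IH => y yw; apply: Aw; rewrite inE yw orbT.
by apply/seteqP; split=> z; [move=> ->; exists [:: x] => //; exists w|case=> _ -> [_ -> <-]].
Qed.

Lemma rational1 x : monoid_gen A = setT -> rational A [set x].
Proof.
move=> AT; have /monoid_gen_words[w Aw ->] : monoid_gen A x by rewrite AT.
exact: rational_word.
Qed.

Lemma rationalU X Y : rational A X -> rational A Y -> rational A (X `|` Y).
Proof.
case=> K [rK ->] [L [rL ->]]; exists (K `|` L); split; first exact: Regular_union.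
by rewrite image_setU.
Qed.

Lemma rationalM X Y : rational A X -> rational A Y -> rational A (setprod X Y).
Proof.
case=> K [rK ->] [L [rL ->]]; eexists; split; first exact: Regular_cat rK rL.
exact: esym (word_prod_catset K L).
Qed.

Lemma rational_monoid_gen X : rational A X -> rational A (monoid_gen X).
Proof.
case=> L [rL ->]; eexists; split; first exact: Regular_star rL.
exact: esym (word_prod_starset L).
Qed.

Lemma rational_finite_union (C : set (set G)) X :
  (forall Y, C Y -> rational A Y) -> finite_union C X -> rational A X.
Proof.
move=> CA [r [Y [CY ->]]]; elim: r Y CY => [|r IH] Y CY.
  by rewrite bigcup_ord0; apply: rational0.
by rewrite bigcup_ordS; apply: rationalU; [apply: CA|apply: IH].
Qed.

(** Words disappear here: since the product map turns the operations on languages into operations on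
    subsets of [G], rational sets can be treated by induction inside the group. Singletons cover
    both the empty word and the letters. *)
Lemma rational_ind_sets (P : set (set G)) :
  P set0 -> (forall x, P [set x]) ->
  (forall X Y, P X -> P Y -> P (X `|` Y)) ->
  (forall X Y, P X -> P Y -> P (setprod X Y)) ->
  (forall X, P X -> P (monoid_gen X)) ->
  forall X, rational A X -> P X.
Proof.
move=> P0 P1 PU PM PS X [L [rL ->]]; rewrite -/(@word_prod G).
elim: rL => [||a _|K {}L _ PK _ PL|K {}L _ PK _ PL|{}L _ PL].
- by rewrite image_set0.
- by rewrite image_set1.
- by rewrite image_set1.
- by rewrite image_setU; apply: PU.
- by rewrite word_prod_catset; apply: PM.
- by rewrite word_prod_starset; apply: PS.
Qed.

End Rational.

Section GroupHom.
Context {V : zmodType} {G : groupType} (iota : V -> G).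
Context (iotaD : {morph iota : x y / (x + y)%R >-> x * y}).

Lemma hom0 : iota 0%R = 1.
Proof. by apply: (mulgI (iota 0%R)); rewrite -iotaD addr0 mulg1. Qed.

Lemma homN x : iota (- x)%R = (iota x)^-1.
Proof. by apply: (mulgI (iota x)); rewrite -iotaD subrr mulgV hom0. Qed.

Lemma hom_star (X : set V) : iota @` star X = monoid_gen (iota @` X).
Proof.
apply/seteqP; split; last first.
  apply: monoid_gen_min; last by move=> _ [x Xx <-]; exists x => //; apply: sub_star.
  split; first by exists 0%R; [exact: star0|exact: hom0].
  by move=> _ _ [x Xx <-] [y Xy <-]; exists (x + y)%R; [exact: starD|exact: iotaD].
move=> _ [x Xx <-]; move: x Xx; apply: star_min.
  split; first by rewrite hom0; apply: monoid_gen1.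
  by move=> x y; rewrite iotaD; apply: monoid_genM.
by move=> x Xx; apply: sub_monoid_gen; exists x.
Qed.

(** The image of a linear set is the product of a singleton, a finitely generated submonoid and the
    singleton of [t]. The homomorphism is arbitrary, so the result serves both the group and its
    powers. *)
Lemma rational_hom_semilinear (A : set G) t X : monoid_gen A = setT ->
  semilinear_set X -> rational A [set iota x * t | x in X].
Proof.
move=> AT [r [Y [HY ->]]]; rewrite image_bigcup.
apply: (@rational_finite_union _ _ (rational A)) => //.
exists r; eexists; split; last reflexivity.
move=> i; have [a [B ->]] := linear_setP (HY i).
rewrite (_ : [set iota x * t | x in lin a B] =
  setprod [set iota a] (setprod (monoid_gen (iota @` [set` B])) [set t])).
  apply: rationalM; first exact: rational1.
  apply: rationalM; last exact: rational1.
  apply: rational_monoid_gen; elim: B => [|b B IH].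
    by rewrite (_ : [set` _] = set0) ?image_set0; [exact: rational0|apply/seteqP; split].
  rewrite (_ : iota @` _ = [set iota b] `|` iota @` [set` B]).
    by apply: rationalU => //; exact: rational1.
  by rewrite -(image_set1 iota) -image_setU set_mem_cons.
rewrite -hom_star /star smallest_lin lin_shift; apply/seteqP; split=> z.
  case=> _ [x xB <-] <-; exists (iota a) => //; exists (iota x * t).
    by exists (iota x); [exists x|exists t].
  by rewrite iotaD mulgA.
case=> _ -> [_ [_ [x xB <-] [_ -> <-]] <-].
by exists (a + x)%R; [exists x|rewrite iotaD mulgA].
Qed.

End GroupHom.

(** * Semilinearity in the coordinates of each coset *)

Definition pull (V : zmodType) (G : groupType) (iota : V -> G) (U : set G) (g : G) : set V :=
  [set z | U (iota z * g)].

(** All [g] are quantified, not just representatives, so that the notion depends on no transversal;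
    [pull_translate] reduces it to one [g] per coset. *)
Definition coset_semilinear (V : zmodType) (G : groupType) (iota : V -> G) (U : set G) : Prop :=
  forall g, semilinear_set (pull iota U g).

Section VirtuallyAbelian.
Context {V : zmodType} {G : groupType} (iota : V -> G).
Context (iotaD : {morph iota : x y / (x + y)%R >-> x * y}).
Context (iota_inj : injective iota).
Context (iotaJ : forall g x, exists y, iota y = g * iota x * g^-1).
Implicit Types (U W : set G) (g h t : G) (x y z : V).

Lemma conj_additive g : exists p : {additive V -> V},
  forall x, iota (p x) = g * iota x * g^-1.
Proof.
have [p pE] := choice (iotaJ g).
have pB : zmod_morphism p.
  move=> x y; apply: iota_inj; rewrite iotaD (homN iotaD) !pE iotaD (homN iotaD).
  by rewrite !invgM invgK !mulgA mulgVK.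
by exists (additive_of pB).
Qed.

Lemma conj_swap g (p : {additive V -> V}) x :
  (forall x, iota (p x) = g * iota x * g^-1) -> g * iota x = iota (p x) * g.
Proof. by move=> ->; rewrite mulgVK. Qed.

Lemma pull_translate U z g :
  semilinear_set (pull iota U g) -> semilinear_set (pull iota U (iota z * g)).
Proof.
move=> /(semilinear_shift z); rewrite (_ : [set x | _] = pull iota U (iota z * g)) //.
by apply/seteqP; split=> x; rewrite /pull /= iotaD mulgA.
Qed.

Lemma coset_semilinear0 : coset_semilinear iota set0.
Proof. by move=> g; apply: finite_union0. Qed.

Lemma coset_semilinear1 g : coset_semilinear iota [set g].
Proof.
move=> h; have [[z zE]|nz] := pselect (exists z, iota z = g * h^-1).
  rewrite (_ : pull _ _ _ = [set z]); first exact: semilinear1.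
  apply/seteqP; split=> x /=; last by move=> ->; rewrite /pull /= zE mulgVK.
  by move=> xg; apply: iota_inj; rewrite zE -xg mulgK.
rewrite (_ : pull _ _ _ = set0); first exact: finite_union0.
by apply/seteqP; split=> x // xg; apply: nz; exists x; rewrite -xg mulgK.
Qed.

Lemma coset_semilinearU U W : coset_semilinear iota U -> coset_semilinear iota W ->
  coset_semilinear iota (U `|` W).
Proof. by move=> sU sW g; apply: finite_unionU; [apply: sU|apply: sW]. Qed.

Lemma coset_semilinear_seq (s : seq G) : coset_semilinear iota [set` s].
Proof.
elim: s => [|g s IH].
  rewrite (_ : [set` _] = set0); first exact: coset_semilinear0.
  by apply/seteqP; split.
by rewrite set_mem_cons; apply: coset_semilinearU => //; apply: coset_semilinear1.
Qed.

(** Moving [iota z] to the left of [g] conjugates it, so the set is the preimage of a [pull] under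
    conjugation by [g]. As this is invertible, it is also the image under conjugation by [g^-1]. *)
Lemma semilinear_pull_mid U g h : coset_semilinear iota U ->
  semilinear_set [set z | U (g * iota z * h)].
Proof.
move=> sU; have [p pE] := conj_additive g; have [q qE] := conj_additive g^-1.
rewrite (_ : [set z | _] = q @` pull iota U (g * h)).
  exact/semilinear_image/sU.
apply/seteqP; split=> z.
  move=> Uz; exists (p z); first by rewrite /pull /= mulgA -(conj_swap _ pE).
  by apply: iota_inj; rewrite qE pE invgK !mulgA mulVg mul1g mulgVK.
case=> x Ux <- /=; rewrite qE invgK !mulgA mulgV mul1g.
by move: Ux; rewrite /pull /= mulgA.
Qed.

Context (Ts : seq G).
Context (Ts_cover : forall g, exists2 t, t \in Ts & exists z, g = iota z * t).

(** Write the left factor as [iota x * t] with [t] a representative; the right factor is then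
    [t^-1 * iota y * g] with [x + y] the coordinate of the product. The union over [t] is finite. *)
Lemma coset_semilinearM U W : coset_semilinear iota U -> coset_semilinear iota W ->
  coset_semilinear iota (setprod U W).
Proof.
move=> sU sW g.
rewrite (_ : pull _ _ _ = [set z | exists2 t, t \in Ts &
    sumset (pull iota U t) [set y | W (t^-1 * iota y * g)] z]).
  apply: finite_union_seq => t _; apply: semilinear_sumset; first exact: sU.
  exact: semilinear_pull_mid.
apply/seteqP; split=> z.
  case=> u Uu [w Ww uw]; have [t tTs [x xE]] := Ts_cover u.
  exists t => //; exists x; first by rewrite /pull /= -xE.
  exists (z - x)%R; last by rewrite addrC subrK.
  rewrite /= addrC iotaD (homN iotaD) -!mulgA -uw xE.
  by rewrite !mulgA mulgVK mulVg mul1g.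
case=> t tTs [x Ux [y Wy <-]]; exists (iota x * t) => //.
exists (t^-1 * iota y * g) => //.
by rewrite iotaD !mulgA mulgK.
Qed.

(** The graph has an edge from [c] to [d] labelled [x] when [c^-1 * iota x * d] is in [U] or is 1.
    Composing edges cancels the middle vertex, so labels add as group elements multiply. Conversely
    a product is cut into edges by passing through the representative of the coset reached after
    each factor. *)
Lemma coset_semilinear_monoid_gen U : coset_semilinear iota U ->
  coset_semilinear iota (monoid_gen U).
Proof.
move=> sU.
pose U1 := [set 1] `|` U.
have sU1 : coset_semilinear iota U1 by apply: coset_semilinearU => //; apply: coset_semilinear1.
pose E (c d : G) : set V := [set x | U1 (c^-1 * iota x * d)].
pose W (c d : G) : set V := [set x | monoid_gen U (c^-1 * iota x * d)].
(* The vertex 1 is added as a starting point: walks from 1 to [t] spell the part of the monoid in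
   the coset of [t]. *)
pose S := 1 :: Ts.
have WE c d : c \in S -> d \in S -> W c d = walks E S c d.
  move=> cS dS; apply/seteqP; split; last first.
    apply: walks_min => [c' d' x [xE|Ux]|c'|c' s d' x y Wx Wy].
    - by rewrite /W /= xE; apply: monoid_gen1.
    - exact: sub_monoid_gen.
    - by rewrite /W /= (hom0 iotaD) mulg1 mulVg; apply: monoid_gen1.
    - rewrite /W /= (_ : _ * _ * _ = (c'^-1 * iota x * s) * (s^-1 * iota y * d')).
        exact: monoid_genM.
      by rewrite iotaD !mulgA mulgK.
  have Q m : monoid_gen U m -> forall c' d' x, c' \in S -> d' \in S ->
      c'^-1 * iota x * d' = m -> walks E S c' d' x.
    move: m; apply: monoid_gen_min; last first.
      by move=> m Um c' d' x _ _ xE; apply: sub_walks; right; rewrite xE.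
    split; first by move=> c' d' x _ _ xE; apply: sub_walks; left.
    move=> m1 m2 Q1 Q2 c' d' x c'S d'S xE.
    (* The intermediate vertex [e] represents the coset of [c' * m1]; then [y] is the label of the
       first part and [x - y] that of the second. *)
    have [e eTs [y yE]] := Ts_cover (c' * m1).
    have eS : e \in S by rewrite inE eTs orbT.
    have -> : x = (y + (x - y))%R by rewrite addrC subrK.
    apply: (walksD eS).
      by apply: Q1 => //; rewrite -mulgA -yE mulKg.
    apply: Q2 => //; apply: (mulgI (c' * m1)); rewrite -[RHS]mulgA -xE yE.
    rewrite !mulgA mulgV mul1g mulgK -iotaD.
    by rewrite addrC subrK.
  by move=> x Wx; apply: (Q _ Wx).
move=> g; have [t tTs [z ->]] := Ts_cover g; apply: pull_translate.
rewrite (_ : pull _ _ _ = W 1 t).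
  rewrite WE ?mem_head ?inE ?tTs ?orbT //.
  by apply: semilinear_walks => c d; apply: semilinear_pull_mid.
by apply/seteqP; split=> x; rewrite /W /pull /= invg1 mul1g.
Qed.

Lemma rational_coset_semilinear A U : rational A U -> coset_semilinear iota U.
Proof.
apply: rational_ind_sets.
- exact: coset_semilinear0.
- exact: coset_semilinear1.
- exact: coset_semilinearU.
- exact: coset_semilinearM.
- exact: coset_semilinear_monoid_gen.
Qed.

Lemma coset_semilinear_rational A U : monoid_gen A = setT ->
  coset_semilinear iota U -> rational A U.
Proof.
move=> AT sU; have sU' t : rational A [set iota x * t | x in pull iota U t].
  exact: rational_hom_semilinear.
rewrite (_ : U = [set g | exists2 t, t \in Ts & [set iota x * t | x in pull iota U t] g]).
  apply: (@rational_finite_union _ _ (rational A)) => //.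
  by apply: finite_union_seq => t _; apply: finite_union1.
apply/seteqP; split=> g; last by case=> t _ [x Ux <-].
move=> Ug; have [t tTs [x xE]] := Ts_cover g.
by exists t => //; exists x; rewrite ?xE // /pull /= -xE.
Qed.

Lemma N_semilinear_coset_semilinear U :
  N_semilinear (range iota) U -> coset_semilinear iota U.
Proof.
case=> r [Y [HY _ ->]] g; rewrite (_ : pull _ _ _ = \bigcup_i pull iota (Y i) g); last first.
  by apply/seteqP; split=> z; case=> i _ Yz; exists i.
apply: finite_union_ord => i; have [a [B [BN [s [b [-> _ _] _ ->]]]]] := HY i.
rewrite (_ : [set a * x | x in _] = setprod [set a] (monoid_gen (range b))).
  apply: coset_semilinearM; first exact: coset_semilinear1.
  apply: coset_semilinear_monoid_gen.
  rewrite (_ : range b = [set` [seq b i | i <- enum 'I_s]]); first exact: coset_semilinear_seq.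
  apply/seteqP; split=> z; first by case=> j _ <-; apply/mapP; exists j; rewrite ?mem_enum.
  by case/mapP=> j _ ->; exists j.
apply/seteqP; split=> z; first by case=> x Bx <-; exists a => //; exists x.
by case=> _ -> [x Bx <-]; exists x.
Qed.

End VirtuallyAbelian.

(** * Disjoint decompositions inside the group *)

Section NSemilinear.
Context {G : groupType} (N : set G).
Implicit Types (X Y : set G).

Lemma N_semilinear0 : N_semilinear N set0.
Proof.
exists 0%N, (fun=> set0); split=> [[]|i j|] //; last by rewrite bigcup_ord0.
by case: i.
Qed.

Lemma N_semilinear1 X : N_linear N X -> N_semilinear N X.
Proof.
move=> NX; exists 1%N, (fun=> X); split=> // [i j _ _ _|].
  by rewrite [i]ord1 [j]ord1.
by rewrite bigcup_ordS bigcup_ord0 setU0.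
Qed.

Lemma N_semilinearU X Y : N_semilinear N X -> N_semilinear N Y ->
  (forall z, X z -> ~ Y z) -> N_semilinear N (X `|` Y).
Proof.
case=> r [F [NF tF XE]] [s [H [NH tH YE]]] dis.
exists (r + s)%N, (fun i => match fintype.split i with inl j => F j | inr j => H j end).
split; last by rewrite XE YE bigcup_split.
  by move=> i /=; case: fintype.split.
move=> i j _ _ [z /= [zi zj]].
rewrite -(splitK i) -(splitK j); move: zi zj.
case: (fintype.split i) => i'; case: (fintype.split j) => j' zi zj.
- by congr (lshift _ _); apply: (tF i' j') => //; exists z.
- by case: (dis z); [rewrite XE; exists i'|rewrite YE; exists j'].
- by case: (dis z); [rewrite XE; exists j'|rewrite YE; exists i'].
- by congr (rshift _ _); apply: (tH i' j') => //; exists z.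
Qed.

End NSemilinear.

Section Cosets.
Context {V : zmodType} {G : groupType} (iota : V -> G).
Context (iotaD : {morph iota : x y / (x + y)%R >-> x * y}).
Context (iota_inj : injective iota).
Context (iotaJ : forall g x, exists y, iota y = g * iota x * g^-1).
Implicit Types (U W : set G) (g h t : G) (x y z : V) (B : seq V).

Lemma homX x n : iota (x *+ n)%R = iota x ^+ n.
Proof. by elim: n => [|n IH]; rewrite ?(hom0 iotaD) // mulrS iotaD IH expgS. Qed.

Lemma free_abelian_basis_zfree B : zfree B ->
  finite_free_abelian_basis (iota @` [set` B]).
Proof.
move=> fr; exists (size B), (fun i => iota (B`_i)%R); split.
- apply/seteqP; split=> z; last by case=> i _ <-; exists (B`_i)%R => //; apply: mem_nth.
  case=> b /(nthP 0%R)[i iB <-] <-.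
  by exists (Ordinal iB).
- by move=> i j; rewrite /commute -!iotaD addrC.
move=> n m; pose f (n : {ffun 'I_(size B) -> nat}) (i : nat) : int :=
  if insub i is Some j then (n j)%:Z else 0%R.
have fE n' (i : 'I_(size B)) : f n' i = (n' i)%:Z.
  by rewrite /f insubT //= => iB; congr (Posz (n' _)); apply: val_inj.
have prodE (n' : {ffun 'I_(size B) -> nat})
    : \prod_(i < size B) iota (B`_i)%R ^+ n' i = iota (comb (f n') B).
  rewrite comb_sum (big_morph iota iotaD (hom0 iotaD)); apply: eq_bigr => i _.
  by rewrite fE -homX.
rewrite !prodE => /iota_inj/(zfree_inj fr) E.
by apply/ffunP => i; have := E i (ltn_ord i); rewrite !fE => -[].
Qed.

Lemma zfree_conj g (p : {additive V -> V}) B :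
  (forall x, iota (p x) = g * iota x * g^-1) -> zfree B -> zfree (map p B).
Proof.
move=> pE fr f; rewrite -comb_map => pf0 i; rewrite size_map; apply: fr.
apply: iota_inj; rewrite (hom0 iotaD).
have : iota (p (comb f B)) = 1 by rewrite pf0 (hom0 iotaD).
rewrite pE => /(congr1 (fun h => g^-1 * h * g)).
by rewrite !mulgA mulVg mul1g mulgVK mulg1 mulVg.
Qed.

(** In an N-linear set the base stands on the left, so [t] has to be moved past the generators:
    [iota (a + x) * t] is [iota a * t] times the conjugate of [iota x] by [t^-1]. Conjugation
    preserves independence. *)
Lemma N_linear_coset_lin t a B : zfree B ->
  N_linear (range iota) [set iota x * t | x in lin a B].
Proof.
move=> fr; have [p pE] := conj_additive iotaD iota_inj iotaJ t^-1.
exists (iota a * t), (iota @` [set` map p B]); split.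
- by move=> _ [x _ <-]; exists x.
- exact/free_abelian_basis_zfree/(zfree_conj pE).
- split=> [x Bx|x y _ _ /mulgI//|_ [x Bx <-]]; first by exists x.
  by exists x.
rewrite -(hom_star iotaD) /star smallest_lin lin_shift.
have -> : lin 0%R (map p B) = p @` lin 0%R B by rewrite lin_image raddf0.
apply/seteqP; split=> z.
  case=> _ [x xB <-] <-; exists (iota (p x)); first by exists (p x) => //; exists x.
  by rewrite pE invgK iotaD !mulgA mulgK.
case=> _ [_ [x xB <-] <-] <-; exists (a + x)%R; first by exists x.
by rewrite pE invgK iotaD !mulgA mulgK.
Qed.

Lemma dlin_N_semilinear t X : dlin X ->
  N_semilinear (range iota) [set iota x * t | x in X].
Proof.
elim=> [|a B Y fr dY IH dis]; first by rewrite image_set0; apply: N_semilinear0.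
rewrite image_setU; apply: N_semilinearU => //.
  by apply: N_semilinear1; apply: N_linear_coset_lin.
move=> _ [x xB <-] [y Yy /mulIg/iota_inj yx].
by apply: (dis x) => //; rewrite -yx.
Qed.

Lemma coset_N_semilinear (s : seq G) U :
  {in s &, forall t t' : G, (exists x, t' = iota x * t) -> t = t'} -> uniq s ->
  (forall t, t \in s -> dlin (pull iota U t)) ->
  N_semilinear (range iota)
    [set g | exists2 t, t \in s & exists2 x, pull iota U t x & iota x * t = g].
Proof.
elim: s => [|t s IH] dis.
  move=> _ _; rewrite (_ : [set g | _] = set0); first exact: N_semilinear0.
  by apply/seteqP; split=> z // [].
move=> /= /andP[ts us] dU.
rewrite (_ : [set g | _] = [set iota x * t | x in pull iota U t] `|`
  [set g | exists2 t, t \in s & exists2 x, pull iota U t x & iota x * t = g]).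
  apply: N_semilinearU.
  - by apply: dlin_N_semilinear; apply: dU; rewrite mem_head.
  - apply: IH => // [u v us' vs|u us']; last by apply: dU; rewrite inE us' orbT.
    by apply: dis; rewrite inE ?us' ?vs orbT.
  move=> _ [x Ux <-] [t' t's [y Uy yx]]; move: ts; rewrite (dis t t') ?t's ?mem_head //.
    by rewrite inE t's orbT.
  by exists (- y + x)%R; rewrite iotaD (homN iotaD) -mulgA -yx mulKg.
apply/seteqP; split=> z.
  move=> [u]; rewrite inE => /orP[/eqP->|us'] Uz; first by left.
  by right; exists u.
case=> [[x Ux <-]|[u us' Uz]]; first by exists t; [rewrite mem_head|exists x].
by exists u => //; rewrite inE us' orbT.
Qed.

(** A transversal injects into the finite set of cosets, hence is finite and can be listed. *)
Lemma transversal_seq T : finite_index (range iota) -> coset_transversal (range iota) T ->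
  exists s : seq G, [/\ uniq s, T = [set` s],
    {in s &, forall t t' : G, (exists x, t' = iota x * t) -> t = t'} &
    forall g, exists2 t, t \in s & exists z, g = iota z * t].
Proof.
move=> fi tT.
have Tinj t t' : T t -> T t' -> (exists x, t' = iota x * t) -> t = t'.
  move=> Tt Tt' [x xE]; have [u [_ uu]] := tT t'.
  have <- : u = t by apply: uu; split=> //; exists (iota x); [exists x|].
  apply: uu; split=> //; exists 1; last by rewrite mul1g.
  by exists 0%R => //; exact: hom0.
have fT : finite_set T.
  pose r (C : set G) : G := xget 1 [set t | T t /\ right_coset (range iota) t = C].
  apply: (sub_finite_set _ (finite_image r fi)) => t Tt.
  exists (right_coset (range iota) t); first by exists t.
  have : T (r (right_coset (range iota) t)) /\
      right_coset (range iota) (r (right_coset (range iota) t)) = right_coset (range iota) t.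
    by apply: (@xgetPex _ 1 [set u | T u /\ right_coset (range iota) u = _]); exists t.
  move: (r _) => u [Tu uE]; apply/esym/Tinj => //.
  have : right_coset (range iota) t u.
    rewrite -uE; exists 1; last by rewrite mul1g.
    by exists 0%R => //; exact: hom0.
  by case=> _ [x _ <-] xE; exists x.
have [s0 sE] := (finite_seqP _).1 fT; exists (undup s0); split.
- exact: undup_uniq.
- by rewrite sE; apply/seteqP; split=> z /=; rewrite mem_undup.
- move=> t t'; rewrite !mem_undup => ts t's; apply: Tinj; rewrite sE //.
- move=> g; have [t [[Tt [_ [x _ <-] <-]] _]] := tT g.
  by exists t; [rewrite mem_undup; move: Tt; rewrite sE|exists x].
Qed.

End Cosets.

(** * Definable sets *)

Lemma iota_conj (V : Type) (G : groupType) (iota : V -> G) :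
  normal_subgroup (range iota) -> forall g x, exists y, iota y = g * iota x * g^-1.
Proof.
case=> _ nrm g x; have [|y _ yE] := nrm g (iota x); first by exists x.
by exists y.
Qed.

Lemma cosets_cover (V : zmodType) (G : groupType) (iota : V -> G) :
  {morph iota : x y / (x + y)%R >-> x * y} -> finite_index (range iota) ->
  exists s : seq G, forall g, exists2 t, t \in s & exists z, g = iota z * t.
Proof.
move=> iotaD fi; have [s sE] := (finite_seqP _).1 (finite_image (xget 1) fi).
exists s => g; exists (xget 1 (right_coset (range iota) g)).
  have : (xget 1 @` range (right_coset (range iota))) (xget 1 (right_coset (range iota) g)).
    by exists (right_coset (range iota) g) => //; exists g.
  by rewrite sE.
have : right_coset (range iota) g (xget 1 (right_coset (range iota) g)).
  by apply: xgetPex; exists (1 * g); exists 1 => //; exists 0%R; rewrite ?(hom0 iotaD).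
case=> _ [x _ <-] <-; exists (- x)%R.
by rewrite (homN iotaD) mulKg.
Qed.

Section Matrices.
Context {m n : nat}.
Implicit Types (X Y : set 'M[int]_(m, n)).

(** The coordinates of a tuple of group elements form a matrix, one row per element. Flattening it
    by [mxvec] transports the complement of row vectors. *)
Lemma semilinearC X : semilinear_set X -> semilinear_set (~` X).
Proof.
move=> /(semilinear_image (additive_of (raddfB mxvec)))/semilinearC_rV.
move=> /(semilinear_image (additive_of (raddfB vec_mx))).
rewrite (_ : _ @` _ = ~` X) //; apply/seteqP; split=> x.
  by case=> y ny <- Xx; apply: ny; exists (vec_mx y); rewrite /= ?vec_mxK.
move=> nXx; exists (mxvec x); last by rewrite /= mxvecK.
by case=> y Xy /= /(can_inj mxvecK) yx; apply: nXx; rewrite -yx.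
Qed.

Lemma semilinearT : semilinear_set [set: 'M[int]_(m, n)].
Proof. by rewrite -setC0; apply/semilinearC/finite_union0. Qed.

Lemma semilinearI X Y : semilinear_set X -> semilinear_set Y -> semilinear_set (X `&` Y).
Proof.
move=> sX sY; rewrite -[X]setCK -[Y]setCK -setCU.
by apply/semilinearC/finite_unionU; apply: semilinearC.
Qed.

Lemma semilinear_fiber k (p : {additive 'M[int]_(m, n) -> 'rV[int]_k}) w :
  semilinear_set [set x | p x = w].
Proof.
pose F j := [set v : 'rV[int]_(m * n) | p (vec_mx v) 0%R j = w 0%R j].
have : semilinear_set (\bigcap_j F j).
  apply/polyhedral_semilinear/finite_union1/finite_inter_ord => j; apply: finite_inter1.
  have H : zmod_morphism (fun v : 'rV[int]_(m * n) => p (vec_mx v) 0%R j).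
    by move=> u v; rewrite !raddfB !mxE.
  exact: (elementary_eq (additive_of H)).
move=> /(semilinear_image (additive_of (raddfB vec_mx))).
rewrite (_ : _ @` _ = [set x | p x = w]) //; apply/seteqP; split=> x.
  by case=> v Fv <-; apply/rowP => j; apply: Fv.
by move=> px; exists (mxvec x); rewrite /= ?mxvecK // => j _; rewrite /F /= mxvecK px.
Qed.

End Matrices.

Section Definable.
Context {k : nat} {G : groupType} (iota : 'rV[int]_k -> G).
Context (iotaD : {morph iota : x y / (x + y)%R >-> x * y}).
Context (iota_inj : injective iota).
Context (iotaJ : forall g x, exists y, iota y = g * iota x * g^-1).
Context (Ts : seq G).
Context (Ts_cover : forall g, exists2 t, t \in Ts & exists z, g = iota z * t).

Definition coset_env n (t : 'I_n -> G) (x : 'M[int]_(n, k)) : 'I_n -> G :=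
  fun i => iota (row i x) * t i.

(** Once the cosets of the variables are fixed, the coset of a term is fixed too, and its coordinate
    depends additively on those of the variables: products and inverses only introduce
    conjugations. *)
Lemma gteval_coset_env n (t : 'I_n -> G) (e : gterm n) :
  exists (p : {additive 'M[int]_(n, k) -> 'rV[int]_k}) g,
    forall x, gteval (coset_env t x) e = iota (p x) * g.
Proof.
elim: e => [i||e1 [p1 [g1 E1]] e2 [p2 [g2 E2]]|e [p [g E]]].
- by exists (additive_of (raddfB (row i))), (t i).
- have H : zmod_morphism ((fun=> 0%R) : 'M[int]_(n, k) -> 'rV[int]_k).
    by move=> x y; rewrite subr0.
  by exists (additive_of H), 1 => x; rewrite /= (hom0 iotaD) mulg1.
- have [c cE] := conj_additive iotaD iota_inj iotaJ g1.
  have H : zmod_morphism (fun x => p1 x + c (p2 x))%R.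
    by move=> x y; rewrite !raddfB opprD addrACA.
  exists (additive_of H), (g1 * g2) => x.
  by rewrite /= E1 E2 iotaD cE !mulgA mulgVK.
- have [c cE] := conj_additive iotaD iota_inj iotaJ g^-1.
  have H : zmod_morphism (fun x => c (- p x))%R.
    by move=> x y; rewrite !raddfB.
  exists (additive_of H), g^-1 => x.
  by rewrite /= E invgM cE (homN iotaD) invgK mulgK.
Qed.

Lemma coset_env_extend n (t : 'I_n -> G) s (x : 'M[int]_(n.+1, k)) :
  extend (iota (row ord0 x) * s) (coset_env t (row' ord0 x)) = coset_env (extend s t) x.
Proof.
apply/funext => i; rewrite /extend /coset_env.
case: unliftP => [j ->|->] //; congr (iota _ * _).
by apply/rowP => l; rewrite !mxE.
Qed.

(** Connectives become Boolean operations. An existential quantifier becomes a finite union, over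
    the coset of the witness, of projections forgetting its row; a universal one is reduced to it by
    two negations. *)
Lemma semilinear_gholds n (f : gform n) (t : 'I_n -> G) :
  semilinear_set [set x | gholds f (coset_env t x)].
Proof.
have ex n' (f' : gform n'.+1) :
    (forall t, semilinear_set [set x | gholds f' (coset_env t x)]) ->
    forall t, semilinear_set [set x | exists g, gholds f' (extend g (coset_env t x))].
  move=> sf t'.
  rewrite (_ : [set x | _] = [set x | exists2 s, s \in Ts &
      (row' ord0 @` [set y | gholds f' (coset_env (extend s t') y)]) x]).
    apply: finite_union_seq => s _.
    exact: (semilinear_image (additive_of (raddfB (row' ord0)))).
  apply/seteqP; split=> x.
    move=> [g fg]; have [s sTs [z gE]] := Ts_cover g; exists s => //.
    pose y : 'M[int]_(n'.+1, k) :=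
      (\matrix_(i, j) if unlift ord0 i is Some i' then x i' j else z 0 j)%R.
    have yx : row' ord0 y = x by apply/matrixP => i j; rewrite !mxE liftK.
    have yz : row ord0 y = z by apply/rowP => j; rewrite !mxE unlift_none.
    by exists y; rewrite //= -coset_env_extend yx yz -gE.
  case=> s sTs [y fy <-]; exists (iota (row ord0 y) * s).
  by rewrite coset_env_extend.
have [C U I] : [/\
    forall n' (X : set 'M[int]_(n', k)), semilinear_set X -> semilinear_set (~` X),
    forall n' (X Y : set 'M[int]_(n', k)), semilinear_set X -> semilinear_set Y ->
      semilinear_set (X `|` Y) &
    forall n' (X Y : set 'M[int]_(n', k)), semilinear_set X -> semilinear_set Y ->
      semilinear_set (X `&` Y)].
  by split=> [n'|n'|n']; [exact: semilinearC|exact: finite_unionU|exact: semilinearI].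
elim: f t => {n} [n e1 e2|n f IH|n f IHf g IHg|n f IHf g IHg|n f IHf g IHg|n f IH|n f IH] t.
- have [p1 [g1 E1]] := gteval_coset_env t e1.
  have [p2 [g2 E2]] := gteval_coset_env t e2.
  have H : zmod_morphism (fun x => p1 x - p2 x)%R.
    by move=> x y; rewrite !raddfB addrACA.
  (* The equation says that [iota (p1 x - p2 x)] is [g2 * g1^-1]: a system of linear equations if
     this element lies in the range of [iota], and impossible otherwise. *)
  have [[w wE]|nw] := pselect (exists w, iota w = g2 * g1^-1).
    rewrite (_ : [set x | _] = [set x | additive_of H x = w]); first exact: semilinear_fiber.
    apply/seteqP; split=> x /=; rewrite E1 E2.
      move=> E; apply: iota_inj; rewrite iotaD (homN iotaD) wE.
      apply: (mulgI (iota (p2 x))); rewrite !mulgA -E mulgK.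
      by rewrite -iotaD addrC iotaD mulgK.
    by move=> E; rewrite -(subrK (p2 x) (p1 x)) E addrC iotaD wE !mulgA mulgVK.
  rewrite (_ : [set x | _] = set0); first exact: finite_union0.
  apply/seteqP; split=> x //=; rewrite E1 E2 => E; apply: nw.
  exists (- p2 x + p1 x)%R; rewrite iotaD (homN iotaD).
  by apply: (mulgI (iota (p2 x))); apply: (mulIg g1); rewrite mulVKg E -!mulgA mulVg mulg1.
- exact/C/IH.
- exact: I (IHf t) (IHg t).
- exact: U (IHf t) (IHg t).
- rewrite (_ : [set x | _] = ~` [set x | gholds f (coset_env t x)] `|`
      [set x | gholds g (coset_env t x)]); first exact: U (C _ _ (IHf t)) (IHg t).
  apply/seteqP; split=> x /=; last by case=> // nf /nf.
  by have [hf|nf] := pselect (gholds f (coset_env t x)); [right; auto|left].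
- exact: ex.
- rewrite (_ : [set x | _] =
      ~` [set x | exists g, gholds (GNot f) (extend g (coset_env t x))]).
    by apply: (C); apply: ex => t'; apply/C/IH.
  apply/seteqP; split=> x /=; first by move=> H [g]; apply; exact: H.
  by move=> H g; apply: contrapT => nf; apply: H; exists g.
Qed.

(** Each parameter acts as its own coset representative, with coordinate zero. The solution set is
    therefore cut down to the matrices whose last [n] rows vanish, and these rows are then
    forgotten. *)
Lemma semilinear_gholds_params q n (f : gform (q + n)) (m : 'I_n -> G) (t : 'I_q -> G) :
  semilinear_set [set x | gholds f (join_env (coset_env t x) m)].
Proof.
have E x : join_env (coset_env t x) m =
    coset_env (join_env t m) (col_mx x (0%R : 'M[int]_(n, k))).
  apply/funext => i; rewrite /join_env /coset_env.
  rewrite -[in row _ _](splitK i); case: (fintype.split i) => j /=.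
    by congr (iota _ * _); apply/rowP => l; rewrite !mxE (unsplitK (inl j)) ?mxE.
  rewrite (_ : row _ _ = 0%R) ?(hom0 iotaD) ?mul1g //.
  by apply/rowP => l; rewrite !mxE (unsplitK (inr j)) ?mxE.
have H : zmod_morphism (fun x : 'M[int]_(q, k) => col_mx x (0%R : 'M[int]_(n, k))).
  by move=> x y; rewrite opp_col_mx add_col_mx subr0.
have := semilinearI (semilinear_gholds f (join_env t m))
  (semilinear_image (additive_of H) (@semilinearT q k)).
move=> /(semilinear_image (additive_of (raddfB usubmx))).
rewrite (_ : _ @` _ = [set x | gholds f (join_env (coset_env t x) m)]) //.
apply/seteqP; split=> x.
  by case=> w [/[swap] [[y _ <-]] fx] <-; rewrite /= col_mxKu E.
rewrite /= E => fx; exists (col_mx x 0%R); last by rewrite /= col_mxKu.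
by split=> //; exists x.
Qed.

(** Applying [iota] row by row gives a homomorphism [j] into the power of the group. [V] is the
    finite union, over choices [c] of representatives for the [q] components, of translated images
    of semilinear sets under [j]. *)
Lemma definable_rational q (A V : set {ffun 'I_q -> G}) :
  monoid_gen A = setT -> definable V -> rational A V.
Proof.
move=> AT [n [f [m ->]]].
pose j (x : 'M[int]_(q, k)) : {ffun 'I_q -> G} := [ffun i => iota (row i x)].
have jD : {morph j : x y / (x + y)%R >-> x * y}.
  by move=> x y; apply/ffunP => i; rewrite !ffunE raddfD iotaD.
pose tt (c : {ffun 'I_q -> 'I_(size Ts)}) : {ffun 'I_q -> G} := [ffun i => nth 1 Ts (c i)].
pose Y c := [set j x * tt c | x in [set x | gholds f (join_env (coset_env (tt c) x) m)]].
have jE x c : (fun_of_fin (j x * tt c)) = coset_env (tt c) x.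
  by apply/funext => i; rewrite /coset_env !ffunE.
rewrite (_ : [set g | _] = [set g | exists2 c, c \in enum {ffun 'I_q -> 'I_(size Ts)} & Y c g]).
  apply: (@rational_finite_union _ _ (rational A)) => //.
  apply: finite_union_seq => c _; apply: finite_union1.
  apply: rational_hom_semilinear => //; exact: semilinear_gholds_params.
apply/seteqP; split=> g /=; last by case=> c _ [x fx <-]; rewrite jE.
have /choice[c cP] : forall i, exists l : 'I_(size Ts), exists z, g i = iota z * nth 1 Ts l.
  move=> i; have [t /(nthP 1)[l ls lE] [z zE]] := Ts_cover (g i).
  by exists (Ordinal ls), z; rewrite /= lE.
have [z zE] := choice cP.
have gE : g = j (\matrix_i z i)%R * tt [ffun i => c i].
  by apply/ffunP => i; rewrite !ffunE rowK.
move=> fg; exists [ffun i => c i]; first by rewrite mem_enum.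
by exists (\matrix_i z i)%R; rewrite // /= -jE -gE.
Qed.

End Definable.

Lemma cosetwise_pull k (G : groupType) (iota : 'rV[int]_k -> G) (U : set G) t :
  injective iota ->
  iota @^-1` [set g * t^-1 | g in U `&` right_coset (range iota) t] = pull iota U t.
Proof.
move=> iota_inj; apply/seteqP; split=> z.
  by case=> g [Ug _] zE; rewrite /pull /= -zE mulgVK.
move=> Uz; exists (iota z * t); last by rewrite mulgK.
by split=> //; exists (iota z) => //; exists z.
Qed.

Theorem theorem1p2 :
  (forall n : nat, (1 <= n)%N ->
     forall U : set 'rV[int]_n, polyhedral_set U <-> semilinear_set U)
  /\
  (forall (G : groupType) (k : nat) (iota : 'rV[int]_k -> G),
     finitely_generated G ->
     embedding iota ->
     normal_subgroup (range iota) ->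
     finite_index (range iota) ->
     (forall T A : set G,
        coset_transversal (range iota) T ->
        finite_monoid_generating_set A ->
        forall U : set G,
          [<-> cosetwise_polyhedral iota T U;
               rational A U;
               N_semilinear (range iota) U])
     /\
     (forall q : nat, (1 <= q)%N ->
        forall A : set {ffun 'I_q -> G},
        finite_monoid_generating_set A ->
        forall V : set {ffun 'I_q -> G}, definable V -> rational A V)).
Proof.
split=> [n _ U|G k iota _ [iotaD iota_inj] /iota_conj iotaJ fi].
  exact: polyhedral_semilinear.
split=> [T A trT [_ AT] U|q _ A [_ AT] V]; last first.
  have [Ts Ts_cover] := cosets_cover iotaD fi.
  exact: (definable_rational iotaD iota_inj iotaJ Ts_cover AT).
have [Ts [Ts_uniq TE Ts_dis Ts_cover]] := transversal_seq iotaD fi trT.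
tfae.
- move=> cU; apply: (coset_semilinear_rational iotaD Ts_cover AT) => g.
  have [t tTs [z ->]] := Ts_cover g; apply: pull_translate => //.
  by rewrite -cosetwise_pull //; apply/polyhedral_semilinear/cU; rewrite TE.
(* Semilinearity alone gives overlapping pieces. Passing through polyhedral sets turns each
   coordinate set into a disjoint union of free linear sets, and distinct representatives keep the
   cosets apart. *)
- move=> /(rational_coset_semilinear iotaD iota_inj iotaJ Ts_cover) sU.
  rewrite (_ : U = [set g | exists2 t, t \in Ts & exists2 x, pull iota U t x & iota x * t = g]).
    apply: coset_N_semilinear => // t _.
    by have /polyhedral_semilinear/polyhedral_dlin[] := sU t.
  apply/seteqP; split=> g; last by case=> t _ [x Ux <-].
  move=> Ug; have [t tTs [x xE]] := Ts_cover g; exists t => //.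
  by exists x; rewrite ?xE // /pull /= -xE.
- move=> /(N_semilinear_coset_semilinear iotaD iota_inj iotaJ Ts_cover) sU t _.
  by rewrite cosetwise_pull //; apply/polyhedral_semilinear/sU.
Qed.
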